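(* Given finite families $L_1,\dots,L_{d+1}$ of hyperplanes in $\mathbb{R}^d$ in general position, there are subfamilies $L_i'\subset L_i$, $1\le i\le d+1$, with $$|L_i'|\ \ge\ 2^{-O(d^4\log(d+1))}\,|L_i| ,$$ where the constant implied by $O(\cdot)$ is absolute, and a point $q\in\mathbb{R}^d$ such that for every $(h_1,\dots,h_{d+1})\in L_1'\times\cdots\times L_{d+1}'$, $q$ lies in the unique bounded simplex $\Delta(h_1,\dots,h_{d+1})$ enclosed by $\bigcup_{i=1}^{d+1}h_i$.
   Context: The families $L_1,\dots,L_{d+1}$ of hyperplanes in $\mathbb{R}^d$ are in general position if no element of $\bigcup_{i=1}^{d+1}L_i$ passes through the origin, any $d$ elements of $\bigcup_{i=1}^{d+1}L_i$ have precisely one point in common, and no $d+1$ of them have a nonempty intersection. For hyperplanes $h_1\in L_1,\dots,h_{d+1}\in L_{d+1}$, $\Delta(h_1,\dots,h_{d+1})$ denotes the unique bounded simplex enclosed by $\bigcup_{i=1}^{d+1}h_i$, that is, the $d$-simplex whose facets lie on $h_1,\dots,h_{d+1}$. *)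

(* Defs.v *)
From HB Require Import structures.
From mathcomp Require Import all_boot all_order all_algebra.
From mathcomp Require Import all_classical all_reals all_analysis.

Set Implicit Arguments.
Unset Strict Implicit.
Unset Printing Implicit Defensive.

Import Order.TTheory GRing.Theory Num.Theory.
Local Open Scope classical_set_scope.
Local Open Scope ring_scope.

Definition is_hyperplane (R : realType) (d : nat) (H : set 'rV[R]_d) : Prop :=
  exists (a : 'rV[R]_d) (b : R),
    a != 0 /\ H = [set x | \sum_(k < d) a 0 k * x 0 k = b].

(* The d+1 families are L 0, ..., L d; the i-th one is indexed by the finite
   type I i. Elements of the union of the families are tagged indices
   t : {i & I i}, so the same hyperplane occurring at two places counts as two
   elements. When all I i are nonempty and 0 < d, the last two clauses force
   L to be injective on tagged indices: the members of a family are distinct,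
   and the families are pairwise disjoint. *)
Definition general_position (R : realType) (d : nat) (I : 'I_d.+1 -> finType)
    (L : forall i, I i -> set 'rV[R]_d) : Prop :=
  [/\ forall t : {i & I i}, ~ L (tag t) (tagged t) 0,
      forall A : {set {i & I i}}, #|A| = d ->
        exists p, \bigcap_(t in [set` A]) L (tag t) (tagged t) = [set p]
    & forall A : {set {i & I i}}, #|A| = d.+1 ->
        \bigcap_(t in [set` A]) L (tag t) (tagged t) = set0].

Definition convex_hull (R : realType) (d : nat) (A : set 'rV[R]_d) :
    set 'rV[R]_d :=
  smallest (@convex_set R 'rV[R]_d) A.

Definition affinely_independent (R : realType) (d n : nat)
    (v : 'I_n -> 'rV[R]_d) : Prop :=
  forall w : 'I_n -> R, \sum_i w i = 0 -> \sum_i w i *: v i = 0 ->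
    forall i, w i = 0.

(* The facet lying on h i is the one opposite to the vertex v i. *)
Definition is_enclosed_simplex (R : realType) (d : nat)
    (h : 'I_d.+1 -> set 'rV[R]_d) (D : set 'rV[R]_d) : Prop :=
  exists v : 'I_d.+1 -> 'rV[R]_d,
    [/\ affinely_independent v,
        D = convex_hull (range v)
      & forall i, convex_hull (v @` [set j | j != i]) `<=` h i].

(* Definite description. The default value is empty, so that membership of a
   point entails that an enclosed simplex exists. *)
Definition enclosed_simplex (R : realType) (d : nat)
    (h : 'I_d.+1 -> set 'rV[R]_d) : set 'rV[R]_d :=
  xget set0 [set D | is_enclosed_simplex h D].

(* Main.v *)
Require Import Defs.
From HB Require Import structures.
From mathcomp Require Import all_boot all_order all_algebra.
From mathcomp Require Import all_classical all_reals all_analysis.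
From mathcomp Require Import zify ring.

Set Implicit Arguments.
Unset Strict Implicit.
Unset Printing Implicit Defensive.

Import Order.TTheory GRing.Theory Num.Theory.

(** Write the hyperplanes as [a.x = b].  The proof has a combinatorial half,
    which makes the normals [a] behave alike, and a geometric half, which
    finds the point.

    _The point._  Suppose that for every index [j] the determinant of the [d]
    normals other than the [j]-th has the same sign for all choices of one
    hyperplane per family.  These [d+1] minors, with alternating signs, are the
    coefficients [nu_j] of the linear dependence between the [d+1] normals
    ([minor_dependence]), so the signs of the [nu_j] do not depend on the choice
    either.  With [l_j(x) = a_j.x - b_j], the sum of the [nu_j l_j(x)] is
    constant in [x], the barycentric coordinates of [x] in the enclosed simplex
    are proportional to the numbers [nu_j l_j(x)], and [x] lies in the simplex
    as soon as these do not have opposite signs ([in_enclosed_simplex]).  To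
    find one [x] that works for many choices, take for each family a centerpoint
    of the vectors [(a, b)] in [R^(d+1)].  It is a hyperplane such that, for any
    [x] on it, at least a fraction [1/(d+2)] of the family has [l(x) <= 0] and at
    least such a fraction has [l(x) >= 0].  The minors are multilinear, hence
    keep their sign when normals are replaced by convex combinations of them; so
    the centerpoint hyperplanes of all families but one meet in a single point
    [q].  For those families the side is free, so the remaining family dictates
    it ([deep_point]).

    _The normals._  For one multilinear form [f] of [n] vectors and [n] finite
    families of vectors in [R^m], [homogeneous_subfamilies] finds large
    subfamilies on which [f] has a weakly constant sign.  The tuples of the last
    [n-1] families define linear functionals of the first vector.  By the cutting
    lemma ([cutting]) a positive fraction of the first family lies in one
    simplicial cone that only a tiny proportion of these functionals cross; the
    family may then be replaced by the [m] generators of the cone, which turns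
    [f] into [m] forms of [n-1] vectors that agree in sign on most tuples, and
    induction applies.  Markov's inequality keeps the proportion of bad tuples
    at most [4^-(n+1)], so that at the end, where there is a single empty tuple,
    none is left.

    The cutting lemma is the random sampling argument of Clarkson: a random
    sample of [s] functionals has cells that are covered by few simplicial
    cones, each of them defined by at most [m(m-1)] members of the sample, and the
    chance that a cone which is crossed by many functionals is crossed by no
    member of the sample is exponentially small in [s].

    _The bound._  With [r = d^O(d)] and [s = r d^O(1)], a cutting step divides
    the size by [s^O(d^2) = 2^O(d^3 log d)].  Each family goes through one such
    step for each of the [d] minors in which it appears, which gives
    [2^O(d^4 log d)] in total. *)

Local Open Scope ring_scope.

(** * Random samples that catch every cell crossed too often *)

(** The probability that the conflict set determined by the positions [J] is
    too large and yet avoids the whole sample is at most [(1 - 1/r)^(s - #|K|)]: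
    condition on the values at the positions in [J], which fix the conflict set;
    the other values must then all fall in its complement. *)
Lemma card_survivors (T K : finType) (s r : nat) (J : {ffun K -> 'I_s})
    (X : {ffun K -> T} -> {set T}) (t0 : T) :
  (0 < r)%N -> (#|K| <= s)%N ->
  (#|[set S : {ffun 'I_s -> T} |
        (#|T| < #|X [ffun i => S (J i)]| * r)%N &&
        [forall i, S i \notin X [ffun i => S (J i)]]]| * r ^ (s - #|K|)
   <= #|T| ^ s * r.-1 ^ (s - #|K|))%N.
Proof.
move=> r0 Ks; set bad := [set S | _].
set D := [set J i | i in K].
have cD : (#|D| <= #|K|)%N by exact: leq_imset_card.
have cDC : #|~: D| = (s - #|D|)%N by rewrite cardsCs finset.setCK card_ord.
(* The value t0 is arbitrary: masking keeps only the positions in D. *)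
pose mask (S : {ffun 'I_s -> T}) := [ffun i => if i \in D then S i else t0].
pose frozen (i : 'I_s) : pred T := if i \in D then predT else pred1 t0.
have mfam S : mask S \in family frozen.
  by apply/familyP => i; rewrite !ffunE /frozen; case: ifP => //= _; rewrite inE.
have prodD (a b : nat) :
    (\prod_(i : 'I_s) (if i \in D then a else b) = a ^ #|D| * b ^ (s - #|D|))%N.
  rewrite (bigID (mem D)) /= (eq_bigr (fun=> a)); last by move=> i ->.
  rewrite [X in (_ * X)%N](eq_bigr (fun=> b)); last by move=> i /negbTE ->.
  rewrite !prod_nat_const; congr (_ * _ ^ _)%N.
  by rewrite -cDC; apply: eq_card => i; rewrite !inE.
have cfam : #|family frozen| = (#|T| ^ #|D|)%N.
  rewrite card_family foldrE big_image /=.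
  rewrite (eq_bigr (fun i => if i \in D then #|T| else 1%N)) ?prodD ?exp1n ?muln1 //.
  by move=> i _; rewrite /frozen; case: ifP => _; rewrite ?card1.
have fiber M : (#|[set S in bad | mask S == M]| * r ^ (s - #|D|)
                <= (#|T| * r.-1) ^ (s - #|D|))%N.
  have [->|[S0]] := set_0Vmem [set S in bad | mask S == M]; first by rewrite cards0.
  rewrite !inE => /andP[/andP[big0 _] /eqP M0].
  set X0 := X [ffun i => S0 (J i)] in big0.
  have sub : [set S in bad | mask S == M] \subset
     family (fun i => if i \in D then pred1 (M i) else mem (~: X0)).
    apply/fintype.subsetP => S; rewrite !inE => /andP[/andP[_ /forallP SX] /eqP MS].
    have eqJ : [ffun i => S (J i)] = [ffun i => S0 (J i)].
      apply/ffunP => i; rewrite !ffunE; have := MS; rewrite -M0 => /ffunP/(_ (J i)).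
      by rewrite !ffunE imset_f.
    apply/familyP => i; case: ifP => iD.
      by rewrite inE -MS ffunE iD.
    by rewrite /= inE /X0 -eqJ SX.
  apply: leq_trans (leq_mul (subset_leq_card sub) (leqnn _)) _.
  rewrite card_family foldrE big_image /=.
  rewrite (eq_bigr (fun i => if i \in D then 1 else #|~: X0|)%N) ?prodD; last first.
    by move=> i _; case: ifP => _; rewrite ?card1.
  rewrite exp1n mul1n -expnMn.
  have le : (#|~: X0| * r <= #|T| * r.-1)%N by have := cardsC X0; nia.
  by elim: (s - #|D|)%N => // e IH; rewrite !expnS leq_mul.
have [/eqP e0|e0] := boolP ((s - #|D|)%N == 0%N).
  have Ks0 : (s - #|K| = 0)%N by lia.
  rewrite Ks0 !expn0 !muln1; apply: leq_trans (max_card _) _.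
  by rewrite card_ffun card_ord.
have tot : (#|bad| * r ^ (s - #|D|) <= #|T| ^ s * r.-1 ^ (s - #|D|))%N.
  rewrite -sum1_card (partition_big mask (mem (family frozen))) /=; last by move=> S _; exact: mfam.
  rewrite big_distrl /=.
  apply: (@leq_trans (\sum_(M in family frozen) (#|T| * r.-1) ^ (s - #|D|))%N).
    apply: leq_sum => M _; apply: leq_trans (fiber M); rewrite leq_mul2r; apply/orP; right.
    by rewrite -sum1_card; apply: eq_leq; apply: eq_bigl => S; rewrite !inE.
  rewrite sum_nat_const cfam expnMn mulnA -expnD subnKC //.
  exact: leq_trans cD Ks.
have split : (s - #|D| = (s - #|K|) + (#|K| - #|D|))%N by lia.
move: tot; rewrite split !expnD !mulnA => tot.
have p0 : (0 < r ^ (#|K| - #|D|))%N by rewrite expn_gt0 r0.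
rewrite -(leq_pmul2r p0); apply: leq_trans tot _.
rewrite leq_mul2l; apply/orP; right.
elim: (_ - _)%N => // e IH; rewrite !expnS leq_mul //; lia.
Qed.

(** Union bound over all ways to determine a conflict set from the sample.
    The index [y] stands for data that do not come from the sample. *)
Lemma sampling_net (T Y K : finType) (s r : nat) (X : Y -> {ffun K -> T} -> {set T}) :
  (0 < #|T|)%N -> (0 < r)%N -> (#|K| <= s)%N ->
  (#|Y| * s ^ #|K| * r.-1 ^ (s - #|K|) < r ^ (s - #|K|))%N ->
  exists S : {ffun 'I_s -> T}, forall y (J : {ffun K -> 'I_s}),
    (forall i, S i \notin X y [ffun i => S (J i)]) ->
    (#|X y [ffun i => S (J i)]| * r <= #|T|)%N.
Proof.
move=> T0 r0 Ks small.
have /card_gt0P[t0 _] := T0.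
pose bad (yJ : Y * {ffun K -> 'I_s}) := [set S : {ffun 'I_s -> T} |
  (#|T| < #|X yJ.1 [ffun i => S (yJ.2 i)]| * r)%N &&
  [forall i, S i \notin X yJ.1 [ffun i => S (yJ.2 i)]]].
have [/existsP[S /forallP good]|] := boolP [exists S, [forall yJ, S \notin bad yJ]].
  exists S => y J SX; have := good (y, J); rewrite inE negb_and -leqNgt.
  by case/orP => // /negP[]; apply/forallP => i; exact: SX.
rewrite negb_exists => /forallP allbad; exfalso.
move: small; apply/negP; rewrite -leqNgt.
have p0 : (0 < #|T| ^ s)%N by rewrite expn_gt0 T0.
rewrite -(leq_pmul2l p0).
have cover : (#|T| ^ s <= \sum_yJ #|bad yJ|)%N.
  rewrite -[X in (_ ^ X)%N](card_ord s) -card_ffun -sum1_card.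
  under [leqRHS]eq_bigr do rewrite -sum1_card.
  rewrite (exchange_big_dep predT) //=; apply: leq_sum => S _.
  have := allbad S; rewrite negb_forall => /existsP[yJ]; rewrite negbK => SyJ.
  by rewrite (bigD1 yJ).
apply: leq_trans (leq_mul cover (leqnn _)) _.
rewrite big_distrl /=.
apply: (@leq_trans (\sum_(yJ : Y * {ffun K -> 'I_s}) #|T| ^ s * r.-1 ^ (s - #|K|))%N).
  by apply: leq_sum => yJ _; exact: card_survivors.
by rewrite sum_nat_const card_prod card_ffun card_ord mulnCA.
Qed.

(** * Cells of a central arrangement are covered by few simplicial cones *)

Definition dot (R : pzSemiRingType) (m : nat) (x y : 'rV[R]_m) : R :=
  \sum_(k < m) x 0 k * y 0 k.

Lemma dotE (R : comPzRingType) (m : nat) (x y : 'rV[R]_m) : dot x y = (x *m y^T) 0 0.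
Proof. by rewrite mxE; apply: eq_bigr => k _; rewrite mxE. Qed.

Lemma dotC (R : comPzRingType) (m : nat) (x y : 'rV[R]_m) : dot x y = dot y x.
Proof. by apply: eq_bigr => k _; rewrite mulrC. Qed.

Lemma dotDr (R : comPzRingType) (m : nat) (x y z : 'rV[R]_m) :
  dot x (y + z) = dot x y + dot x z.
Proof. by rewrite !dotE linearD mulmxDr mxE. Qed.

Lemma dotZr (R : comPzRingType) (m : nat) (a : R) (x y : 'rV[R]_m) :
  dot x (a *: y) = a * dot x y.
Proof. by rewrite !dotE linearZ -scalemxAr mxE. Qed.

Lemma dotBr (R : comPzRingType) (m : nat) (x y z : 'rV[R]_m) :
  dot x (y - z) = dot x y - dot x z.
Proof. by rewrite dotDr -scaleN1r dotZr mulN1r. Qed.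

Lemma dotNr (R : comPzRingType) (m : nat) (x y : 'rV[R]_m) : dot x (- y) = - dot x y.
Proof. by rewrite -scaleN1r dotZr mulN1r. Qed.

Lemma dot_sumr (R : comPzRingType) (m : nat) (I : Type) (s : seq I) (P : pred I)
    (x : 'rV[R]_m) (F : I -> 'rV[R]_m) :
  dot x (\sum_(i <- s | P i) F i) = \sum_(i <- s | P i) dot x (F i).
Proof.
elim/big_rec2: _ => [|i a b _ <-]; last by rewrite dotDr.
by rewrite dotE trmx0 mulmx0 mxE.
Qed.

Definition spanning (R : fieldType) (n m : nat) (M : 'M[R]_(n, m)) : Prop :=
  forall x : 'rV[R]_m, (forall i, dot (row i M) x = 0) -> x = 0.

(** Rows are blanked rather than deleted, so that the matrices belonging to
    different points have the same shape and their row spaces can be compared.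
    The rank is the codimension of the face of the arrangement that contains
    [v]: it is maximal on the rays of the arrangement. *)
Definition zero_rows (R : fieldType) (n m : nat) (M : 'M[R]_(n, m)) (v : 'rV[R]_m) :=
  \matrix_(i < n) if dot (row i M) v == 0 then row i M else 0.

(** The point [u] lies in the closure of the face of [v]. *)
Definition conform (R : realFieldType) (n m : nat) (M : 'M[R]_(n, m)) (u v : 'rV[R]_m) :=
  forall i, 0 <= dot (row i M) u * dot (row i M) v /\
            (dot (row i M) v = 0 -> dot (row i M) u = 0).

Lemma conform_refl (R : realFieldType) (n m : nat) (M : 'M[R]_(n, m)) v : conform M v v.
Proof. by move=> i; split=> //; rewrite -expr2 sqr_ge0. Qed.

Lemma conform_trans (R : realFieldType) (n m : nat) (M : 'M[R]_(n, m)) u v w :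
  conform M u v -> conform M v w -> conform M u w.
Proof.
move=> uv vw i; have [uv1 uv2] := uv i; have [vw1 vw2] := vw i.
split; last by move/vw2/uv2.
have [/eqP/uv2 ->|v0] := boolP (dot (row i M) v == 0); first by rewrite mul0r.
have v2 : 0 < dot (row i M) v ^+ 2 by rewrite exprn_even_gt0.
rewrite -(pmulr_rge0 _ v2); move: (mulr_ge0 uv1 vw1); congr (0 <= _); ring.
Qed.

(** The kernel of [zero_rows M v] is the linear span of the face of [v]. *)
Lemma zero_rows_kernel (R : fieldType) (n m : nat) (M : 'M[R]_(n, m)) (v x : 'rV[R]_m) :
  (forall i, dot (row i M) v = 0 -> dot (row i M) x = 0) <-> zero_rows M v *m x^T = 0.
Proof.
split=> [H|H i vi].
  apply/colP => i; rewrite mxE [RHS]mxE.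
  case: (eqVneq (dot (row i M) v) 0) => [/[dup] vi /H xi|vi].
    rewrite -[RHS]xi; apply: eq_bigr => k _; rewrite !mxE vi eqxx mxE //.
  by apply: big1 => k _; rewrite !mxE (negbTE vi) mxE mul0r.
move/colP: H => /(_ i); rewrite [RHS]mxE => <-.
by rewrite mxE; apply: eq_bigr => k _; rewrite !mxE vi eqxx mxE.
Qed.

Lemma rank_zero_rows_lt (R : fieldType) (n m : nat) (M : 'M[R]_(n, m)) (v v' : 'rV[R]_m) (i : 'I_n) :
  (forall i, dot (row i M) v = 0 -> dot (row i M) v' = 0) ->
  dot (row i M) v != 0 -> dot (row i M) v' = 0 ->
  (\rank (zero_rows M v) < \rank (zero_rows M v'))%N.
Proof.
move=> sub vi v'i; apply: rank_ltmx; rewrite ltmxE; apply/andP; split.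
  apply/row_subP => j; rewrite rowK; case: eqP => [vj|_]; last exact: sub0mx.
  apply: submx_trans (row_sub j _); rewrite rowK (sub _ vj) eqxx //.
apply/negP => le; have : (row i M <= zero_rows M v)%MS.
  by apply: submx_trans le; apply: submx_trans (row_sub i _); rewrite rowK v'i eqxx.
case/submxP => D rowE; move/eqP: vi; apply; rewrite dotE rowE -mulmxA.
by have /zero_rows_kernel -> : forall i, dot (row i M) v = 0 -> dot (row i M) v = 0; rewrite ?mulmx0 ?mxE.
Qed.

Lemma rank_zero_rows_max (R : fieldType) (n m : nat) (M : 'M[R]_(n, m)) (v : 'rV[R]_m) :
  v != 0 -> (\rank (zero_rows M v) < m)%N.
Proof.
move=> v0; have /zero_rows_kernel /mulmx0_rank_max : forall i, dot (row i M) v = 0 -> dot (row i M) v = 0 by [].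
by rewrite mxrank_tr rank_rV v0 addn1.
Qed.

(** Moving from [v] against a direction [y] of its face, the first functional
    that vanishes puts the point on a face of smaller dimension, and until then
    no functional changes sign. *)
Lemma walk_to_wall (R : realFieldType) (n m : nat) (M : 'M[R]_(n, m)) (v y : 'rV[R]_m) (i0 : 'I_n) :
  (forall i, dot (row i M) v = 0 -> dot (row i M) y = 0) ->
  0 < dot (row i0 M) v * dot (row i0 M) y ->
  exists t, [/\ 0 < t, conform M (v - t *: y) v &
    (\rank (zero_rows M v) < \rank (zero_rows M (v - t *: y)%R))%N].
Proof.
move=> vy pos.
pose P i := 0 < dot (row i M) v * dot (row i M) y.
pose F i := dot (row i M) v / dot (row i M) y.
pose j := [arg min_(i < i0 | P i) F i]%O.
have [Pj jmin] : P j /\ forall i, P i -> F j <= F i.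
  by rewrite /j; case: arg_minP.
have sgF i : P i -> 0 < F i.
  rewrite /P /F => Pi; have yi : dot (row i M) y != 0.
    by apply: contraTneq Pi => ->; rewrite mulr0 ltxx.
  have y2 : 0 < dot (row i M) y ^+ 2 by rewrite exprn_even_gt0.
  rewrite -(pmulr_rgt0 _ y2); move: Pi; congr (0 < _); field; exact: yi.
have cf : conform M (v - F j *: y) v.
  move=> i; rewrite dotBr dotZr; split; last by move=> /[dup] /vy -> ->; rewrite mulr0 subr0.
  rewrite mulrBl subr_ge0; have [Pi|nPi] := boolP (P i); last first.
    rewrite /P -leNgt in nPi; apply: le_trans (_ : 0 <= _).
      by rewrite -mulrA pmulr_rle0 ?sgF // mulrC.
    by rewrite -expr2 sqr_ge0.
  have yi : dot (row i M) y != 0 by apply: contraTneq Pi => y0; rewrite /P y0 mulr0 ltxx.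
  have -> : dot (row i M) v * dot (row i M) v = F i * dot (row i M) y * dot (row i M) v.
    by rewrite /F; field.
  rewrite -[leLHS]mulrA -[leRHS]mulrA; apply: ler_wpM2r; last exact: jmin.
  by rewrite mulrC ltW.
exists (F j); split=> //; first exact: sgF.
have yj : dot (row j M) y != 0 by apply: contraTneq Pj => y0; rewrite /P y0 mulr0 ltxx.
apply: (rank_zero_rows_lt (i := j)).
- by move=> i; case: (cf i) => _; exact.
- by apply: contraTneq Pj => y0; rewrite /P y0 mul0r ltxx.
- by rewrite dotBr dotZr /F; field.
Qed.

(** Closed faces of a spanning arrangement are pointed cones, so they contain
    a ray: as long as the face of [v] has dimension at least two, some direction
    of it, or its opposite, leads to a wall and does not end at the origin. *)
Lemma exists_vertex (R : realFieldType) (n m : nat) (M : 'M[R]_(n, m)) (v : 'rV[R]_m) :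
  spanning M -> v != 0 ->
  exists u, [/\ u != 0, (\rank (zero_rows M u)).+1 = m & conform M u v].
Proof.
move=> spM; have [N] := ubnP (m - \rank (zero_rows M v))%N.
elim: N v => // N IH v leN v0.
have ltv := rank_zero_rows_max M v0.
have [e|ne] := eqVneq (\rank (zero_rows M v)).+1 m.
  by exists v; split=> //; exact: conform_refl.
have : ~~ (kermx (zero_rows M v)^T <= v)%MS.
  apply/negP => /mxrankS; rewrite mxrank_ker mxrank_tr rank_rV v0; lia.
case/row_subPn => j; set y := row j _ => yv.
have vy i : dot (row i M) v = 0 -> dot (row i M) y = 0.
  move: i; apply/zero_rows_kernel; apply: trmx_inj; rewrite trmx_mul trmxK trmx0.
  by apply/sub_kermxP; exact: row_sub.
have y0 : y != 0 by apply: contraNneq yv => ->; exact: sub0mx.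
have [i yi] : exists i, dot (row i M) y != 0.
  apply: contra_notP => [H|]; last exact: (negP y0).
  by apply/eqP/spM => i; apply/eqP; apply: contra_notT H => ?; exists i.
have vi : dot (row i M) v != 0 by apply: contra_neq yi; exact: vy.
have step y' : (y' = y \/ y' = - y) -> 0 < dot (row i M) v * dot (row i M) y' ->
    exists u, [/\ u != 0, (\rank (zero_rows M u)).+1 = m & conform M u v].
  move=> y'E pos.
  have vy' k : dot (row k M) v = 0 -> dot (row k M) y' = 0.
    by move/vy => yk; case: y'E => ->; rewrite ?dotNr yk ?oppr0.
  have [t [t0 cf rk]] := walk_to_wall vy' pos.
  have v'0 : v - t *: y' != 0.
    rewrite subr_eq0; apply: contraNneq yv => vE.
    apply/sub_rVP; case: y'E vE => -> ->.
      by exists t^-1; rewrite scalerA mulVf ?scale1r // gt_eqF.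
    by exists (- t^-1); rewrite scalerA mulNr mulVf ?scaleN1r ?opprK // gt_eqF.
  have [|u [u0 ru cu]] := IH _ _ v'0; first by lia.
  by exists u; split=> //; exact: conform_trans cu cf.
have : dot (row i M) v * dot (row i M) y != 0 by rewrite mulf_neq0.
case: (ltgtP (dot (row i M) v * dot (row i M) y) 0) => // [neg|pos] _.
  by apply: (step (- y)); [right|rewrite dotNr mulrN oppr_gt0].
by apply: (step y) => //; left.
Qed.

(** Conical version of triangulating a polytope from one of its vertices:
    walk from [v] away from a ray [u] of its closed face until the boundary is
    hit, and decompose the point of arrival.  All weights are strictly positive
    and exactly [k] rays are used, repetitions being allowed; strictness matters
    later, when a functional may vanish at a point of the cone. *)
Lemma vertex_decomposition (R : realFieldType) (n m : nat) (M : 'M[R]_(n, m))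
    (v : 'rV[R]_m) (k : nat) :
  spanning M -> v != 0 -> (m - \rank (zero_rows M v) <= k)%N ->
  exists (w : 'I_k -> R) (u : 'I_k -> 'rV[R]_m),
    v = \sum_i w i *: u i /\
    forall i, [/\ 0 < w i, u i != 0, (\rank (zero_rows M (u i))).+1 = m & conform M (u i) v].
Proof.
move=> spM; elim: k v => [|k IH] v v0 lek; have ltv := rank_zero_rows_max M v0; first by lia.
have [e|ne] := eqVneq (\rank (zero_rows M v)).+1 m.
  exists (fun=> k.+1%:R^-1), (fun=> v); split.
    by rewrite sumr_const card_ord -scaler_nat scalerA mulfV ?scale1r ?pnatr_eq0.
  by move=> i; split; rewrite ?invr_gt0 ?ltr0n //; exact: conform_refl.
have [u [u0 ru cu]] := exists_vertex spM v0.
have [i ui] : exists i, dot (row i M) u != 0.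
  apply: contra_notP => [H|]; last exact: (negP u0).
  by apply/eqP/spM => i; apply/eqP; apply: contra_notT H => ?; exists i.
have vi : dot (row i M) v != 0 by apply: contra_neq ui; case: (cu i).
have pos : 0 < dot (row i M) v * dot (row i M) u.
  by case: (cu i) => + _; rewrite mulrC le_eqVlt eq_sym (negbTE (mulf_neq0 vi ui)).
have uv j : dot (row j M) v = 0 -> dot (row j M) u = 0 by case: (cu j).
have [t [t0 cf rk]] := walk_to_wall uv pos.
have v'0 : v - t *: u != 0.
  rewrite subr_eq0; apply: contraNneq ne => vE; rewrite -[X in _ == X]ru.
  have -> // : zero_rows M v = zero_rows M u.
  by apply/row_matrixP => j; rewrite !rowK vE dotZr mulf_eq0 (gt_eqF t0).
have [|w [us [vE H]]] := IH _ v'0; first by lia.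
exists (fun i => oapp w t (unlift ord0 i)), (fun i => oapp us u (unlift ord0 i)); split.
  rewrite big_ord_recl unlift_none /=.
  under eq_bigr do rewrite liftK /=.
  by rewrite -vE addrC subrK.
move=> j; case: unliftP => [j' _|_] /=; last by split.
by have [? ? ? cj] := H j'; split=> //; exact: conform_trans cj cf.
Qed.

Definition ray (R : fieldType) (k m : nat) (N : 'M[R]_(k, m)) : 'rV[R]_m := nz_row (kermx N^T).

(** This bounds the number of rays: up to a scalar, each one is determined by
    [m] rows of the arrangement. *)
Lemma vertex_ray (R : realFieldType) (n m : nat) (M : 'M[R]_(n, m.+1)) (u : 'rV[R]_m.+1) :
  u != 0 -> \rank (zero_rows M u) = m ->
  exists (J : 'I_m -> 'I_n) (c : R), c != 0 /\ u = c *: ray (rowsub J M).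
Proof.
move=> u0 rk; set A := zero_rows M u in rk.
pose J (i : 'I_m) := maxrankfun A (cast_ord (esym rk) i).
have actJ i : dot (row (J i) M) u = 0.
  apply/eqP; apply: contraT => ne.
  have := maxrowsub_free A => /row_free_inj inj.
  have := inj 1%N (delta_mx 0 (cast_ord (esym rk) i)) 0.
  rewrite -rowE mul0mx row_rowsub rowK (negbTE ne) => /(_ erefl)/matrixP/(_ 0 (cast_ord (esym rk) i)).
  by rewrite !mxE !eqxx => /eqP; rewrite oner_eq0.
have rowJ i : row (J i) M = row (J i) A by rewrite rowK actJ eqxx.
have rkJ : \rank (rowsub J M) = m.
  apply/eqP; rewrite eqn_leq rank_leq_row /= -[leqLHS]rk -(eq_maxrowsub A); apply: mxrankS.
  apply/row_subP => i; rewrite row_rowsub.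
  have -> : maxrankfun A i = J (cast_ord rk i) by rewrite /J cast_ordK.
  by rewrite -rowJ -row_rowsub row_sub.
have uker : (u <= kermx (rowsub J M)^T)%MS.
  apply/sub_kermxP/rowP => i; have := actJ i; rewrite dotC dotE => ui.
  rewrite [RHS]mxE -ui !mxE; apply: eq_bigr => k _; rewrite !mxE //.
have rker : \rank (kermx (rowsub J M)^T) = 1%N by rewrite mxrank_ker mxrank_tr rkJ subSnn.
have ray0 : ray (rowsub J M) != 0 by rewrite nz_row_eq0 -mxrank_eq0 rker.
have /mxrank_leqif_sup/geq_leqif := nz_row_sub (kermx (rowsub J M)^T).
rewrite -/(ray _) rker rank_rV ray0 leqnn => /esym kr.
have /sub_rVP[c uE] := submx_trans uker kr.
exists J, c; split=> //; apply: contraNneq u0 => c0; rewrite uE c0 scale0r //.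
Qed.

(** * A weak cutting lemma *)

Lemma popular_class (E C : finType) (A : {set E}) (G : C -> {set E}) :
  (0 < #|A|)%N -> (forall a, a \in A -> exists c, a \in G c) ->
  exists2 c, (#|A| <= #|A :&: G c| * #|C|)%N & (0 < #|A :&: G c|)%N.
Proof.
move=> A0 cov; suff [c le] : exists c, (#|A| <= #|A :&: G c| * #|C|)%N.
  by exists c => //; move: (leq_trans A0 le); rewrite muln_gt0 => /andP[].
apply/existsP; apply: contraT; rewrite negb_exists => /forallP small.
have cover : (#|A| <= \sum_c #|A :&: G c|)%N.
  rewrite -sum1_card; under [leqRHS]eq_bigr do rewrite -sum1_card.
  rewrite (exchange_big_dep (mem A)) /=; last by move=> c a _; rewrite inE => /andP[].
  apply: leq_sum => a aA; have [c ac] := cov a aA.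
  by rewrite (bigD1 c) //= inE aA ac.
have C0 : (0 < #|C|)%N.
  by have /card_gt0P[a aA] := A0; have [c _] := cov a aA; apply/card_gt0P; exists c.
have : (\sum_c #|A :&: G c| * #|C| < \sum_(c : C) #|A|)%N.
  have /card_gt0P[c0 _] := C0.
  rewrite [ltnLHS](bigD1 c0) //= [ltnRHS](bigD1 c0) //= -addSn.
  apply: leq_add; first by rewrite ltnNge; exact: small.
  by apply: leq_sum => c _; rewrite leqNgt; apply: contra (small c) => /ltnW.
rewrite -big_distrl /= sum_nat_const => lt.
by move: lt; rewrite ltnNge mulnC leq_mul.
Qed.

Definition crossing (R : realFieldType) (m n : nat) (b : 'rV[R]_m) (v : 'I_n -> 'rV[R]_m) : bool :=
  [exists i, exists j, (dot b (v i) < 0) && (0 < dot b (v j))].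

(** The number of simplicial cones considered for a sample of size [s]: each
    of the [m+1] generators is given by a sign and by [m] functionals, every one
    of which is a member of the sample or a coordinate form. *)
Definition cell_count (m s : nat) : nat := (m.+2 * s) ^ (m.+1 * m) * 2 ^ m.+1.

(** Sample [s] functionals and add the coordinate forms, so that the
    arrangement spans.  Every point of [A] lies in the open cone generated by
    [m+1] rays of the closed cell that contains it, and no sampled functional
    crosses this cone; one of the [cell_count m s] possible cones is popular, and
    by the choice of the sample few functionals cross it. *)
Lemma cutting (R : realFieldType) (E T : finType) (m s r : nat) (A : {set E})
    (p : E -> 'rV[R]_m.+1) (g : T -> 'rV[R]_m.+1) :
  (0 < #|A|)%N -> (forall a, a \in A -> p a != 0) -> (0 < #|T|)%N ->
  (0 < r)%N -> (0 < s)%N -> (m.+1 * m <= s)%N ->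
  (cell_count m s * r.-1 ^ (s - m.+1 * m) < r ^ (s - m.+1 * m))%N ->
  exists (v : 'I_m.+1 -> 'rV[R]_m.+1) (A' : {set E}),
    [/\ A' \subset A, (0 < #|A'|)%N, (#|A| <= #|A'| * cell_count m s)%N,
        forall a, a \in A' -> exists w : 'I_m.+1 -> R,
          (forall l, 0 < w l) /\ p a = \sum_l w l *: v l
      & (#|[set t | crossing (g t) v]| * r <= #|T|)%N].
Proof.
move=> A0 p0 T0 r0 s0 ks small.
pose Kt := ('I_m.+1 * 'I_m)%type.
pose Y := ({ffun Kt -> option 'I_m.+1} * {ffun 'I_m.+1 -> bool})%type.
pose cone (y : Y) (z : {ffun Kt -> T}) (l : 'I_m.+1) : 'rV[R]_m.+1 :=
  (-1) ^+ y.2 l *: ray (\matrix_(j < m)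
     if y.1 (l, j) is Some c then delta_mx 0 c else g (z (l, j))).
pose X (y : Y) (z : {ffun Kt -> T}) := [set t | crossing (g t) (cone y z)].
have cK : #|{: Kt}| = (m.+1 * m)%N by rewrite card_prod !card_ord.
have cY : (#|{: Y}| * s ^ #|{: Kt}| = cell_count m s)%N.
  rewrite card_prod !card_ffun cK card_option !card_ord card_bool /cell_count expnMn; lia.
have [||||S HS] := @sampling_net T Y Kt s r X; rewrite ?cK ?cY //; first by rewrite -cK cY cK.
pose M := col_mx (\matrix_(i < s) g (S i)) 1%:M : 'M[R]_(s + m.+1, m.+1).
have rowl i : row (lshift _ i) M = g (S i).
  by rewrite /M rowKu rowK.
have rowr i : row (rshift s i) M = delta_mx 0 i.
  by rewrite /M rowKd row1.
have spM : spanning M.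
  move=> x Hx; apply/rowP => c; rewrite mxE; have := Hx (rshift s c).
  rewrite rowr dotE => xc; have := congr1 (fun t : 'cV[R]_m.+1 => t c 0) (mul1mx x^T).
  by rewrite -row1 -row_mul mxE mul1mx in xc; rewrite mxE in xc *.
(* Filler for the positions at which a coordinate form is used instead. *)
pose i0 := Ordinal s0.
pose seln (S : {ffun 'I_s -> T}) (J : {ffun Kt -> 'I_s}) : {ffun Kt -> T} := [ffun i => S (J i)].
pose good a (c : Y * {ffun Kt -> 'I_s}) :=
  (exists w : 'I_m.+1 -> R, (forall l, 0 < w l) /\
     p a = \sum_l w l *: cone c.1 (seln S c.2) l) /\
  (forall i, S i \notin X c.1 (seln S c.2)).
have cov a : a \in A -> exists c, a \in [set a | `[< good a c >]].
  move=> aA; have pa := p0 a aA.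
  have [|w [u [paE uP]]] := vertex_decomposition (k := m.+1) spM pa; first exact: leq_subr.
  have /choice[Jc JcP] : forall l, exists Jc : ('I_m -> 'I_(s + m.+1)) * R,
      Jc.2 != 0 /\ u l = Jc.2 *: ray (rowsub Jc.1 M).
    move=> l; have [_ u0 [ru] _] := uP l.
    by have [J [c Hc]] := vertex_ray u0 ru; exists (J, c).
  pose y : Y := ([ffun k : Kt => if fintype.split ((Jc k.1).1 k.2) is inr c then Some c else None],
                 [ffun l => (Jc l).2 < 0]).
  pose J : {ffun Kt -> 'I_s} :=
    [ffun k : Kt => if fintype.split ((Jc k.1).1 k.2) is inl i then i else i0].
  have uE l : u l = `|(Jc l).2| *: cone y (seln S J) l.
    have [_ ->] := JcP l; rewrite /cone scalerA [y.2 l]ffunE [`|_| * _]mulrC -numEsign.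
    congr (_ *: ray _); apply/row_matrixP => j; rewrite row_rowsub rowK !ffunE /=.
    by case: split_ordP => k ->; rewrite ?rowl ?rowr.
  have c0 l : 0 < `|(Jc l).2| by rewrite normr_gt0; case: (JcP l).
  exists (y, J); rewrite inE; apply/asboolP; split.
    exists (fun l => w l * `|(Jc l).2|); split=> [l|].
      by rewrite mulr_gt0 //; case: (uP l).
    by rewrite paE; apply: eq_bigr => l _; rewrite uE scalerA.
  move=> i; rewrite inE; apply/negP => /existsP[l1 /existsP[l2 /andP[neg pos]]].
  (* All generators are conform to p a, hence do not take opposite signs at a sampled row. *)
  have cf l := let: And4 _ _ _ H := uP l in H (lshift _ i).
  have := cf l1; have := cf l2; rewrite !rowl !uE ![dot _ (`|_| *: _)]dotZr.
  have {}neg : `|(Jc l1).2| * dot (g (S i)) (cone y (seln S J) l1) < 0 by rewrite pmulr_rlt0.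
  have {}pos : 0 < `|(Jc l2).2| * dot (g (S i)) (cone y (seln S J) l2) by rewrite pmulr_rgt0.
  case=> [h2 z2] [h1 z1].
  rewrite pmulr_rge0 // in h2; rewrite nmulr_rge0 // in h1.
  have e : dot (g (S i)) (p a) = 0 by apply/eqP; rewrite eq_le h1 h2.
  by move/eqP: (lt0r_neq0 pos); apply; exact: (z2 e).
have [c leA A'0] := popular_class A0 cov.
exists (cone c.1 (seln S c.2)), (A :&: [set a | `[< good a c >]]).
have /card_gt0P[a1] := A'0; rewrite !inE => /andP[_ /asboolP[_ nX]].
split=> //.
- exact: finset.subsetIl.
- by rewrite -cY -[in X in (_ * X ^ _)%N](card_ord s) -card_ffun -card_prod.
- by move=> a; rewrite !inE => /andP[_ /asboolP[]].
- exact: HS.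
Qed.

(** * Homogenising multilinear forms *)

(** Arguments are given as a sequence, and [f] is unconstrained on sequences
    of a size other than [n]; this makes it easy to fix the first argument. *)
Definition multilinear (R : pzSemiRingType) (V : lSemiModType R) (n : nat) (f : seq V -> R) : Prop :=
  forall (s1 s2 : seq V) (a : R) (x y : V), (size s1 + size s2).+1 = n ->
    f (s1 ++ (a *: x + y) :: s2) = a * f (s1 ++ x :: s2) + f (s1 ++ y :: s2).

Lemma multilinear_cons (R : pzSemiRingType) (V : lSemiModType R) (n : nat) (f : seq V -> R) (x : V) :
  multilinear n.+1 f -> multilinear n (fun s => f (x :: s)).
Proof. by move=> fL s1 s2 a y z e; apply: (fL (x :: s1)); rewrite /= addSn e. Qed.

Lemma multilinear_head_sum (R : pzRingType) (V : lmodType R) (n : nat) (f : seq V -> R)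
    (I : Type) (r : seq I) (P : pred I) (w : I -> R) (v : I -> V) (s : seq V) :
  multilinear n.+1 f -> size s = n ->
  f (\sum_(i <- r | P i) w i *: v i :: s) = \sum_(i <- r | P i) w i * f (v i :: s).
Proof.
move=> fL sn; have lin a x y : f (a *: x + y :: s) = a * f (x :: s) + f (y :: s).
  by apply: (fL [::]); rewrite sn.
have f0 : f (0 :: s) = 0.
  by have := lin (-1) 0 0; rewrite scaler0 addr0 mulN1r addNr.
elim/big_rec2: _ => // i a b _ <-; exact: lin.
Qed.

Fixpoint transversals (E : finType) (As : seq {set E}) : seq (seq E) :=
  if As is A :: As' then [seq x :: t | x <- enum A, t <- transversals As'] else [:: [::]].

Lemma transversals_cons (E : finType) (A : {set E}) As t :
  t \in transversals (A :: As) <-> exists x t', [/\ t = x :: t', x \in A & t' \in transversals As].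
Proof.
split=> [/allpairsP[[x t'] /= [xA tt ->]]|[x [t' [-> xA tt]]]].
  by exists x, t'; split; rewrite // -mem_enum.
by apply/allpairsP; exists (x, t'); rewrite mem_enum.
Qed.

Lemma size_transversal (E : finType) (As : seq {set E}) t :
  t \in transversals As -> size t = size As.
Proof.
elim: As t => [t|A As IH t]; first by rewrite inE => /eqP ->.
by case/transversals_cons => x [t' [-> _ /IH /= ->]].
Qed.

Lemma count_transversals_cons (E : finType) (P : pred (seq E)) (A : {set E}) As :
  count P (transversals (A :: As)) =
  (\sum_(x in A) count (fun t => P (x :: t)) (transversals As))%N.
Proof.
rewrite /= /allpairs_dep count_flatten sumnE !big_map big_enum /=.
by apply: eq_bigr => x _; rewrite count_map.
Qed.

Definition coherent (R : numDomainType) (J : finType) (F : J -> R) : bool :=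
  [forall j, 0 <= F j] || [forall j, F j <= 0].

(** If the values of a functional at the generators of a cone do not have
    opposite signs, then its sign at one point of the open cone decides its weak
    sign on the whole cone.  With a zero weight allowed this would fail for a
    functional vanishing at the point. *)
Lemma one_sided (R : realDomainType) (L : finType) (w G : L -> R) :
  (forall l, 0 < w l) -> (forall l1 l2, G l1 < 0 -> 0 < G l2 -> False) ->
  0 <= \sum_l w l * G l -> forall l, 0 <= G l.
Proof.
move=> w0 nc; apply: contraPP => /existsNP[l /negP]; rewrite -ltNge => Gl.
apply/negP; rewrite -ltNge (bigD1 l) //= ltr_wnDr //; last by rewrite pmulr_rlt0.
apply: sumr_le0 => k _; rewrite pmulr_rle0 // leNgt; apply/negP; exact: nc Gl.
Qed.

Lemma functional_vector (R : comPzRingType) (m n : nat) (f : seq 'rV[R]_m -> R) (s : seq 'rV[R]_m) x :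
  multilinear n.+1 f -> size s = n ->
  f (x :: s) = dot (\row_k f (delta_mx 0 k :: s)) x.
Proof.
move=> fL sn; rewrite [in LHS](row_sum_delta x) (multilinear_head_sum _ _ _ _ fL sn).
by apply: eq_bigr => k _; rewrite mxE mulrC.
Qed.

(** Markov's inequality: at least half of the elements have a cost at most
    twice the average bound. *)
Lemma halving (E : finType) (A : {set E}) (b : E -> nat) (q z : nat) :
  (0 < z)%N -> ((\sum_(x in A) b x) * q <= #|A| * z)%N ->
  (#|A| <= 2 * #|[set x in A | (b x * q <= 2 * z)%N]|)%N.
Proof.
move=> z0 le; set L := [set x in A | _].
have cA : (#|L| + #|A :\: L| = #|A|)%N.
  rewrite -(cardsID L A); congr (_ + _)%N.
  by apply: eq_card => x; rewrite !inE; case: (x \in A).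
have : (#|A :\: L| * (2 * z) <= \sum_(x in A) b x * q)%N.
  rewrite (big_setID (A :\: L)) /= -sum_nat_const.
  have -> : A :&: (A :\: L) = A :\: L by apply/setP => x; rewrite !inE; case: (x \in A); rewrite ?andbF.
  apply: leq_trans (leq_addr _ _); apply: leq_sum => x; rewrite !inE => /andP[h xA].
  by move: h; rewrite xA /= -ltnNge => /ltnW.
rewrite -big_distrl /= => le2; have := leq_trans le2 le.
rewrite mulnA leq_pmul2r //; lia.
Qed.

Lemma leq_count_in (T : eqType) (P Q : pred T) (s : seq T) :
  (forall x, x \in s -> P x -> Q x) -> (count P s <= count Q s)%N.
Proof.
elim: s => //= x s IH PQ; apply: leq_add; last by apply: IH => y ys; apply: PQ; rewrite inE ys orbT.
by case Px: (P x) => //; rewrite (PQ x) ?mem_head.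
Qed.

(** Induction on the number of families, for a finite set of forms that agree
    in sign on all but a proportion [4^-(n+1)] of the transversals.  First the
    points of [A] with few bad transversals are kept, at least half of them by
    [halving]; then these are cut with respect to all functionals
    [f j (_ :: t)].  A transversal [t] of the other families that is not
    crossed, and is good together with a single point of the cone, is good
    together with all generators of the cone.  The number of forms is multiplied
    by [m+1] in each step, hence the hypothesis on [r]. *)
Lemma homogeneous_subfamilies (R : realFieldType) (E : finType) (m s r : nat) (p : E -> 'rV[R]_m.+1) :
  (0 < r)%N -> (0 < s)%N -> (m.+1 * m <= s)%N ->
  (cell_count m s * r.-1 ^ (s - m.+1 * m) < r ^ (s - m.+1 * m))%N ->
  forall (As : seq {set E}) (J : finType) (f : J -> seq 'rV[R]_m.+1 -> R),
  (forall A, A \in As -> (0 < #|A|)%N /\ forall a, a \in A -> p a != 0) ->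
  (forall j, multilinear (size As) (f j)) ->
  (0 < #|J|)%N -> (#|J| * (8 * m.+1) ^ size As <= r)%N ->
  (count [pred t | ~~ coherent (fun j => f j (map p t))] (transversals As) * 4 ^ (size As).+1
     <= size (transversals As))%N ->
  exists As' : seq {set E},
    [/\ size As' = size As,
        forall i, (i < size As)%N -> let A := nth finset.set0 As i in let A' := nth finset.set0 As' i in
          [/\ A' \subset A, (0 < #|A'|)%N & (#|A| <= #|A'| * (2 * cell_count m s))%N]
      & (forall t j, t \in transversals As' -> 0 <= f j (map p t)) \/
        (forall t j, t \in transversals As' -> f j (map p t) <= 0)].
Proof.
move=> r0 s0 ks small; elim=> [|A As IH] J f Ap fL J0 Jr /=.
  move=> bad; exists [::]; split=> //; move: bad; rewrite addn0.
  case co: (coherent _) => //= _.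
  by case/orP: co => /forallP H; [left|right] => t j; rewrite inE => /eqP -> ; exact: H.
rewrite -/(transversals (A :: As)) count_transversals_cons size_allpairs -cardE => bad.
set Ts := transversals As in bad *; set n := size As in bad *.
have [A0 pA] := Ap A (mem_head _ _).
have sz0 : (0 < size Ts)%N.
  have : forall B, B \in As -> (0 < #|B|)%N by move=> B BA; case: (Ap B); rewrite // inE BA orbT.
  rewrite /Ts; elim: (As) => //= B Bs IHs pos.
  rewrite size_allpairs muln_gt0 -cardE pos ?mem_head //= IHs // => C CB; apply: pos.
  by rewrite inE CB orbT.
have szT t : t \in Ts -> size (map p t) = n by move=> tT; rewrite size_map (size_transversal tT).
pose b x := count (fun t => ~~ coherent (fun j => f j (p x :: map p t))) Ts.
have hA := halving (b := b) sz0 bad.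
set At := [set x in A | _] in hA.
have At0 : (0 < #|At|)%N by lia.
pose g (k : 'I_(size Ts) * J) : 'rV[R]_m.+1 :=
  \row_c f k.2 (delta_mx 0 c :: map p (nth [::] Ts k.1)).
have gE i j x : dot (g (i, j)) x = f j (x :: map p (nth [::] Ts i)).
  by rewrite (functional_vector _ (fL j)) // szT // mem_nth.
have [||v [A' [sA' A'0 cA' wA' cr]]] := cutting (p := p) g At0 _ _ r0 s0 ks small.
- by move=> a; rewrite inE => /andP[/pA].
- by rewrite card_prod card_ord muln_gt0 sz0.
rewrite card_prod card_ord in cr.
have /card_gt0P[x0 x0A'] := A'0.
have x0At := fintype.subsetP sA' _ x0A'.
pose f' (k : J * 'I_m.+1) t := f k.1 (v k.2 :: t).
pose crossed t := [exists j, crossing (\row_c f j (delta_mx 0 c :: map p t)) v].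
have countX : (count crossed Ts <= #|[set t | crossing (g t) v]|)%N.
  rewrite -sum1_count (big_nth [::]) big_mkord sum1_card.
  apply: leq_trans (leq_imset_card (fun k => k.1) _); apply: subset_leq_card.
  apply/fintype.subsetP => i /existsP[j cj]; apply/imsetP; exists (i, j); rewrite ?inE //.
have badle : (count [pred t | ~~ coherent (fun k => f' k (map p t))] Ts <= b x0 + count crossed Ts)%N.
  rewrite /b -count_predUI; apply: leq_trans (leq_addr _ _).
  apply: leq_count_in => t tT; apply: contraLR => /=.
  rewrite negb_or negbK => /andP[co ncr].
  have [w [w0 x0E]] := wA' _ x0A'.
  have fE j : f j (p x0 :: map p t) = \sum_l w l * f j (v l :: map p t).
    by rewrite x0E (multilinear_head_sum _ _ _ _ (fL j)) // szT.
  have nc j l1 l2 : f j (v l1 :: map p t) < 0 -> 0 < f j (v l2 :: map p t) -> False.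
    move=> lt0 gt0; move/negP: ncr; apply; apply/existsP; exists j; apply/existsP; exists l1.
    by apply/existsP; exists l2; rewrite -!(functional_vector _ (fL j)) ?szT // lt0 gt0.
  apply/negPn/orP; case/orP: co => /forallP co; [left|right]; apply/forallP => -[j l] /=; rewrite /f' /=.
    apply: (one_sided (L := 'I_m.+1) (w := w) (G := fun l => f j (v l :: map p t))) l => //.
      exact: nc.
    by rewrite -fE.
  rewrite -oppr_ge0.
  apply: (one_sided (L := 'I_m.+1) (w := w) (G := fun l => - f j (v l :: map p t))) l => //.
    by move=> l1 l2; rewrite oppr_lt0 oppr_gt0 => h1 h2; exact: nc h2 h1.
  by under eq_bigr do rewrite mulrN; rewrite sumrN -fE oppr_ge0.
have bx0 : (b x0 * 4 ^ n.+2 <= 2 * size Ts)%N by move: x0At; rewrite inE => /andP[].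
have J'r : (#|{: J * 'I_m.+1}| * (8 * m.+1) ^ n <= r)%N.
  apply: leq_trans Jr; rewrite card_prod card_ord expnS -mulnA leq_mul2l; apply/orP; right.
  rewrite leq_mul2r; apply/orP; right; lia.
have [||||As' [szAs' subAs' signs]] := IH (J * 'I_m.+1)%type f' _ _ _ J'r.
- by move=> B BA; apply: Ap; rewrite inE BA orbT.
- by move=> [j l]; exact: multilinear_cons.
- by rewrite card_prod card_ord muln_gt0 J0.
- apply: leq_trans (leq_mul badle (leqnn _)) _.
  have crosses : (count crossed Ts * (8 * m.+1) ^ n.+1 <= size Ts)%N.
    rewrite -(leq_pmul2l J0) mulnCA; apply: leq_trans (leq_mul (leqnn _) Jr) _.
    by rewrite [(#|J| * _)%N]mulnC; apply: leq_trans cr; rewrite leq_mul2r countX orbT.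
  have e8 : (2 * 4 ^ n.+1 <= (8 * m.+1) ^ n.+1)%N.
    elim: (n) => [|k IHk]; first by rewrite !expn1; lia.
    by rewrite expnS [leqRHS]expnS mulnCA leq_mul //; lia.
  have := leq_trans (leq_mul (leqnn _) e8) crosses.
  move: bx0; rewrite -/n -/Ts (expnS 4 n.+1) mulnDl; lia.
exists (A' :: As'); split.
- by rewrite /= szAs'.
- case=> [|i] /=; last exact: subAs'.
  move=> _; split=> //; last by rewrite mulnCA; lia.
  by apply: (fintype.subset_trans sA'); apply/fintype.subsetP => x; rewrite inE => /andP[].
- have fE x t j : x \in A' -> t \in transversals As' -> exists w, (forall l, 0 < w l) /\
      f j (map p (x :: t)) = \sum_l w l * f' (j, l) (map p t).
    move=> xA' tT; have [w [w0 xE]] := wA' _ xA'; exists w; split=> //.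
    by rewrite /= xE (multilinear_head_sum _ _ _ _ (fL j)) // size_map (size_transversal tT).
  case: signs => signs; [left|right] => t j /transversals_cons[x [t' [-> xA' tT]]].
    have [w [w0 ->]] := fE x t' j xA' tT; apply: sumr_ge0 => l _.
    by rewrite mulr_ge0 ?(ltW (w0 l)) // signs.
  have [w [w0 ->]] := fE x t' j xA' tT; apply: sumr_le0 => l _.
  by rewrite pmulr_rle0 // signs.
Qed.

(** * Constant signs for all minors of the normals *)

Lemma transversalP (E : finType) (x0 : E) (As : seq {set E}) (t : seq E) :
  reflect (size t = size As /\ forall i, (i < size As)%N -> nth x0 t i \in nth finset.set0 As i)
          (t \in transversals As).
Proof.
elim: As t => [|A As IH] t.
  apply: (iffP idP) => [|[/size0nil -> _]]; last by rewrite inE.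
  by rewrite inE => /eqP ->.
apply: (iffP idP) => [/transversals_cons[x [t' [-> xA /IH[sz tA]]]]|[]].
  by split=> [|[|i]] //=; [rewrite sz|move/tA].
case: t => //= x t [sz] tA; apply/transversals_cons; exists x, t; split=> //.
  exact: (tA 0%N).
by apply/IH; split=> // i; exact: (tA i.+1).
Qed.

Lemma det_multilinear (R : comPzRingType) (n : nat) :
  multilinear n (fun s : seq 'rV[R]_n => \det (\matrix_(i < n) nth 0 s i)).
Proof.
move=> s1 s2 a x y sz; have lt1 : (size s1 < n)%N by lia.
rewrite -[\det (\matrix_i nth 0 (s1 ++ y :: s2) i)]mul1r; apply: (determinant_multilinear (i0 := Ordinal lt1)).
- by apply/rowP => c; rewrite !mxE !nth_cat ltnn subnn /= !mxE mul1r.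
- apply/matrixP => k c; rewrite !mxE !nth_cat; case: ltnP => //= le.
  have /eqP : (lift (Ordinal lt1) k : nat) != size s1 by rewrite eq_sym; exact: (neq_lift (Ordinal lt1) k).
  case e : (_ - _)%N => //. by move=> /= ?; lia.
- apply/matrixP => k c; rewrite !mxE !nth_cat; case: ltnP => //= le.
  have /eqP : (lift (Ordinal lt1) k : nat) != size s1 by rewrite eq_sym; exact: (neq_lift (Ordinal lt1) k).
  case e : (_ - _)%N => //. by move=> /= ?; lia.
Qed.

Definition minor (R : comPzRingType) (n : nat) (j : 'I_n.+1) (v : 'I_n.+1 -> 'rV[R]_n) : R :=
  \det (\matrix_(i < n) v (lift j i)).

Definition selects (I : Type) (E : finType) (A : I -> {set E}) (h : I -> E) :=
  forall i, h i \in A i.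

Lemma selects_sub (I : Type) (E : finType) (A1 A2 : I -> {set E}) (h : I -> E) :
  (forall i, A1 i \subset A2 i) -> selects A1 h -> selects A2 h.
Proof. by move=> s12 hA i; exact: (fintype.subsetP (s12 i)). Qed.

(** The last two requirements pull in opposite directions: [r] must be at least the
    number of functionals that have to be kept uncrossed simultaneously, and [s]
    must be so large that cones crossed by a proportion [1/r] are detected. *)
Definition sample_size_ok (m s r : nat) : Prop :=
  [/\ (0 < r)%N, (0 < s)%N, (m.+1 * m <= s)%N,
      (cell_count m s * r.-1 ^ (s - m.+1 * m) < r ^ (s - m.+1 * m))%N
    & ((8 * m.+1) ^ m.+1 <= r)%N].

Definition omit (T : Type) (n : nat) (A : 'I_n.+1 -> T) (j : 'I_n.+1) : seq T :=
  [seq A (lift j i) | i <- enum 'I_n].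

Lemma size_omit T n (A : 'I_n.+1 -> T) j : size (omit A j) = n.
Proof. by rewrite size_map size_enum_ord. Qed.

Lemma nth_omit T n (A : 'I_n.+1 -> T) j x0 (i : 'I_n) : nth x0 (omit A j) i = A (lift j i).
Proof. by rewrite (nth_map i) ?size_enum_ord // nth_ord_enum. Qed.

(** The minor ignores the [j]-th family, which is left alone; the others are
    cut by [homogeneous_subfamilies], applied to a single form.  No minor
    vanishes, so its weakly constant sign is strictly constant. *)
Lemma one_minor_sign (R : realFieldType) (E : finType) (m s r : nat) (p : E -> 'rV[R]_m.+1)
    (A : 'I_m.+2 -> {set E}) (j : 'I_m.+2) :
  sample_size_ok m s r ->
  (forall i, (0 < #|A i|)%N) ->
  (forall j h, selects A h -> minor j (p \o h) != 0) ->
  exists A' : 'I_m.+2 -> {set E},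
    (forall i, [/\ A' i \subset A i, (0 < #|A' i|)%N
       & (#|A i| <= #|A' i| * (2 * cell_count m s))%N]) /\
    exists tau : bool, forall h, selects A' h -> 0 < (-1) ^+ tau * minor j (p \o h).
Proof.
case=> r0 s0 ks small big A0 nz.
have /fin_all_exists[pick pickA] : forall i, exists e, e \in A i by move=> i; apply/card_gt0P.
pose As := omit A j.
pose f (_ : unit) (s : seq 'rV[R]_m.+1) := \det (\matrix_(i < m.+1) nth 0 s i).
pose fill (t : seq E) i := if unlift j i is Some i' then nth (pick j) t i' else pick j.
have fE t : size t = m.+1 -> f tt (map p t) = minor j (p \o fill t).
  move=> sz; congr (\det _); apply/row_matrixP => i; rewrite !rowK /= (nth_map (pick j)) ?sz //.
  by rewrite /fill liftK.
have fillA As' t : size As' = m.+1 ->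
    (forall i, (i < m.+1)%N -> nth finset.set0 As' i \subset nth finset.set0 As i) ->
    t \in transversals As' -> selects A (fill t).
  move=> szAs' sub /(transversalP (pick j))[sz tA] i; rewrite /fill; case: unliftP => [i' ->|->] //.
  have := tA i'; rewrite szAs' => /(_ (ltn_ord _)) /(fintype.subsetP (sub _ (ltn_ord _))).
  by rewrite nth_omit.
have szAs : size As = m.+1 by rewrite size_omit.
have [|||||As' [szAs' subAs' sgn]] := @homogeneous_subfamilies R E m s r p r0 s0 ks small As unit f.
- move=> B /mapP[i _ ->]; split=> // a aA.
  (* A zero vector would make the minors that involve it vanish. *)
  pose h k := if k == lift j i then a else pick k.
  have hA : selects A h by move=> k; rewrite /h; case: eqP => [->|_].
  apply: contra_neq (nz j h hA) => pa; rewrite /minor (expand_det_row _ i) big1 // => k _.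
  by rewrite !mxE /h /= eqxx pa mxE mul0r.
- by case; rewrite szAs; exact: det_multilinear.
- by rewrite card_unit.
- by rewrite card_unit mul1n szAs.
- rewrite (_ : count _ _ = 0%N) ?mul0n //; apply/eqP; rewrite -leqn0 leqNgt -has_count.
  apply/hasPn => t _ /=; rewrite negbK /coherent; case: (lerP 0 (f tt (map p t))) => h.
    by apply/orP; left; apply/forallP => -[].
  by apply/orP; right; apply/forallP => -[]; rewrite ltW.
rewrite szAs in szAs' subAs'.
exists (fun i => if unlift j i is Some i' then nth finset.set0 As' i' else A i); split.
  move=> i; case: unliftP => [i' ->|->]; last by split=> //; rewrite leq_pmulr // muln_gt0 muln_gt0 !expn_gt0 /= andbT; lia.
  by have := subAs' i' (ltn_ord _); rewrite nth_omit.
have key (P : R -> Prop) : (forall t, t \in transversals As' -> minor j (p \o fill t) != 0 -> P (f tt (map p t))) ->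
   forall h, selects (fun i => if unlift j i is Some i' then nth finset.set0 As' i' else A i) h -> P (minor j (p \o h)).
  move=> HP h hA; pose t := omit h j.
  have tT : t \in transversals As'.
    apply/(transversalP (pick j)); rewrite size_omit szAs'; split=> // i lt.
    by rewrite (nth_omit _ _ _ (Ordinal lt)); have := hA (lift j (Ordinal lt)); rewrite liftK.
  have -> : minor j (p \o h) = f tt (map p t).
    rewrite fE ?size_omit //; congr (\det _); apply/row_matrixP => i; rewrite !rowK /=.
    by rewrite /fill liftK nth_omit.
  by apply: HP => //; apply: nz; apply: (fillA As') => // i lt; case: (subAs' i lt).
case: sgn => sgn; [exists false|exists true] => h hA.
  rewrite expr0 mul1r; apply: (key (fun x => 0 < x)) hA => t tT nzt.
  by rewrite lt_neqAle eq_sym sgn // andbT fE // (size_transversal tT).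
rewrite expr1 mulN1r oppr_gt0; apply: (key (fun x => x < 0)) hA => t tT nzt.
by rewrite lt_neqAle sgn // andbT fE // (size_transversal tT).
Qed.

Lemma minor_signs (R : realFieldType) (E : finType) (m s r : nat) (p : E -> 'rV[R]_m.+1)
    (A : 'I_m.+2 -> {set E}) :
  sample_size_ok m s r ->
  (forall i, (0 < #|A i|)%N) ->
  (forall j h, selects A h -> minor j (p \o h) != 0) ->
  exists A' : 'I_m.+2 -> {set E},
    (forall i, [/\ A' i \subset A i, (0 < #|A' i|)%N
       & (#|A i| <= #|A' i| * (2 * cell_count m s) ^ m.+2)%N]) /\
    exists tau : 'I_m.+2 -> bool, forall j h, selects A' h -> 0 < (-1) ^+ tau j * minor j (p \o h).
Proof.
move=> ok A0 nz.
suff [A' [sub sgn]] : exists A' : 'I_m.+2 -> {set E},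
    (forall i, [/\ A' i \subset A i, (0 < #|A' i|)%N
       & (#|A i| <= #|A' i| * (2 * cell_count m s) ^ size (enum 'I_m.+2))%N]) /\
    forall j, j \in enum 'I_m.+2 -> exists tau : bool, forall h, selects A' h -> 0 < (-1) ^+ tau * minor j (p \o h).
  exists A'; rewrite size_enum_ord in sub; split=> //.
  have /fin_all_exists[tau tauP] : forall j, exists tau : bool,
      forall h, selects A' h -> 0 < (-1) ^+ tau * minor j (p \o h).
    by move=> j; apply: sgn; rewrite mem_enum.
  by exists tau.
elim: (enum _) => [|j js [A' [sub sgn]]].
  by exists A; split=> // i; split; rewrite ?muln1.
have [||A'' [sub' sgn']] := @one_minor_sign R E m s r p A' j ok.
- by move=> i; case: (sub i).
- by move=> k h hA; apply: nz; apply: selects_sub hA => i; case: (sub i).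
exists A''; split=> [i|k].
  have [s1 _ c1] := sub i; have [s2 n2 c2] := sub' i; split=> //.
    exact: fintype.subset_trans s2 s1.
  by rewrite expnS mulnA; apply: leq_trans c1 _; rewrite leq_mul2r c2 orbT.
rewrite inE => /orP[/eqP -> //|kjs]; have [tau tauP] := sgn k kjs.
by exists tau => h hA; apply: tauP; apply: selects_sub hA => i; case: (sub' i).
Qed.

(** Expand in one argument at a time. *)
Lemma multilinear_convex_pos (R : realFieldType) (V : lmodType R) (E : finType) (p : E -> V)
    (As : seq {set E}) (f : seq V -> R) (u : seq V) :
  multilinear (size As) f -> (forall t, t \in transversals As -> 0 < f (map p t)) ->
  size u = size As ->
  (forall i, (i < size As)%N -> exists w : E -> R, [/\ forall e, 0 <= w e,
     \sum_(e in nth finset.set0 As i) w e = 1 &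
     nth 0 u i = \sum_(e in nth finset.set0 As i) w e *: p e]) ->
  0 < f u.
Proof.
elim: As f u => [|A As IH] f u fL pos; first by move/size0nil => -> _; exact: (pos [::]).
case: u => //= x u [sz] cvx; have [w [w0 w1 /= xE]] := cvx 0%N isT.
rewrite xE (multilinear_head_sum _ _ _ _ fL sz).
have fpos e : e \in A -> 0 < f (p e :: u).
  move=> eA; apply: (IH (fun s => f (p e :: s))) => //.
  - exact: multilinear_cons.
  - by move=> t tT; apply: (pos (e :: t)); apply/transversals_cons; exists e, t.
  - by move=> i lt; exact: (cvx i.+1).
rewrite lt_neqAle; apply/andP; split; last by apply: sumr_ge0 => e eA; rewrite mulr_ge0 // ltW // fpos.
apply/negP => /eqP/esym/psumr_eq0P => z.
have : \sum_(e in A) w e = 0.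
  apply: big1 => e eA; have := z (fun e eA => mulr_ge0 (w0 e) (ltW (fpos e eA))) e eA.
  by move/eqP; rewrite mulf_eq0 (gt_eqF (fpos e eA)) orbF => /eqP.
by move/eqP; rewrite w1 oner_eq0.
Qed.

(** * Helly's theorem and centerpoints *)

Lemma affine_dependence (R : fieldType) (K : finType) (D : nat) (Q : {set K}) (z : K -> 'rV[R]_D) :
  (D.+1 < #|Q|)%N ->
  exists u : K -> R, [/\ exists2 k, k \in Q & u k != 0,
    \sum_(k in Q) u k = 0 & \sum_(k in Q) u k *: z k = 0].
Proof.
move=> lt; have /card_gt0P[k0 k0Q] : (0 < #|Q|)%N by lia.
pose N : 'M[R]_(#|Q|, D + 1) := \matrix_i row_mx (z (enum_val i)) 1.
pose v := nz_row (kermx N).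
have v0 : v != 0.
  rewrite nz_row_eq0 -mxrank_eq0 mxrank_ker.
  by have := rank_leq_col N; lia.
have vN : v *m N = 0 by apply/sub_kermxP; exact: nz_row_sub.
pose u k := v 0 (enum_rank_in k0Q k).
have sumE (V : lmodType R) (F : K -> V) :
    \sum_(k in Q) u k *: F k = \sum_(i < #|Q|) v 0 i *: F (enum_val i).
  by rewrite big_enum_val; apply: eq_bigr => i _; rewrite /u enum_valK_in.
have comb : row_mx (\sum_(k in Q) u k *: z k) (\sum_(k in Q) u k *: (1 : 'rV[R]_1)) = 0.
  rewrite -[RHS]vN mulmx_sum_row !sumE.
  under [RHS]eq_bigr do rewrite rowK.
  by elim/big_rec3: _ => [|i a b c _ <-]; rewrite ?row_mx0 // scale_row_mx add_row_mx.
exists u; split.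
- have [i vi] : exists i, v 0 i != 0.
    apply/existsP; apply: contraT; rewrite negb_exists => /forallP v00.
    by case/eqP: v0; apply/rowP => i; rewrite mxE; apply/eqP; have := v00 i; rewrite negbK.
  by exists (enum_val i); rewrite ?enum_valP // /u enum_valK_in.
- have /(congr1 (fun M : 'rV_(D + 1) => M 0 (rshift D 0))) := comb.
  rewrite row_mxEr mxE summxE => e; rewrite -[RHS]e; apply: eq_bigr => k _.
  by rewrite !mxE mulr1.
- by have := congr1 lsubmx comb; rewrite row_mxKl => ->; apply/rowP => i; rewrite !mxE.
Qed.

(** Radon's proof: pick a common point of each subfamily that omits one set;
    an affine dependence between these points splits them into two groups with a
    common convex combination, which lies in every set. *)
Lemma helly (R : realFieldType) (K : finType) (D : nat) (C : K -> 'rV[R]_D -> Prop) (Q : {set K}) :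
  (forall k (P : pred K) (c : K -> R) (z : K -> 'rV[R]_D),
     (forall i, P i -> 0 <= c i) -> \sum_(i | P i) c i = 1 ->
     (forall i, P i -> C k (z i)) -> C k (\sum_(i | P i) c i *: z i)) ->
  (forall Q' : {set K}, Q' \subset Q -> (#|Q'| <= D.+1)%N -> exists x, forall k, k \in Q' -> C k x) ->
  exists x, forall k, k \in Q -> C k x.
Proof.
move=> cvx; have [N] := ubnP #|Q|; elim: N Q => // N IH Q ltN few.
have [le|gt] := leqP #|Q| D.+1; first exact: few.
have /fin_all_exists[z zP] : forall k, exists x, k \in Q -> forall j, j \in Q :\ k -> C j x.
  move=> k; have [kQ|] := boolP (k \in Q); last by exists 0.
  have [|Q' sub|x xP] := IH (Q :\ k); last by exists x.
    by rewrite (cardsD1 k Q) kQ in ltN.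
  by apply: few; apply: fintype.subset_trans sub (subD1set _ _).
have [u [[k1 k1Q uk1] u0 uz0]] := affine_dependence z gt.
pose s := \sum_(k in Q | 0 < u k) u k.
have splitu : s + \sum_(k in Q | ~~ (0 < u k)) u k = 0 by rewrite /s -bigID.
have splitz : \sum_(k in Q | 0 < u k) u k *: z k + \sum_(k in Q | ~~ (0 < u k)) u k *: z k = 0.
  by rewrite -bigID.
have s0 : 0 < s.
  rewrite lt_neqAle sumr_ge0 ?andbT; last by move=> k /andP[_ /ltW].
  apply/negP => /eqP/esym sz.
  have [uk|uk] := boolP (0 < u k1).
    have /psumr_eq0P := sz => /(_ (fun k h => ltW (andP h).2))/(_ k1); rewrite k1Q uk => /(_ isT) e.
    by rewrite e eqxx in uk1.
  move: splitu; rewrite sz add0r => /eqP; rewrite -oppr_eq0 -sumrN => /eqP/psumr_eq0P H.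
  move/eqP: uk1; apply; apply: oppr_inj; rewrite oppr0; apply: H; last by rewrite k1Q uk.
  by move=> k /andP[_]; rewrite -leNgt oppr_ge0.
(* The Radon point. *)
pose x := \sum_(k in Q | 0 < u k) (u k / s) *: z k.
have xE : x = \sum_(k in Q | ~~ (0 < u k)) (- u k / s) *: z k.
  rewrite /x; under eq_bigr do rewrite mulrC -scalerA.
  under [RHS]eq_bigr do rewrite mulrC -scalerA scaleNr.
  rewrite -!scaler_sumr sumrN; congr (_ *: _); apply/eqP; rewrite -addr_eq0; exact/eqP.
exists x => j jQ; have [uj|uj] := boolP (0 < u j).
  rewrite xE; apply: cvx => [k /andP[_]||k /andP[kQ uk]].
  - by rewrite -leNgt => uk; rewrite divr_ge0 ?oppr_ge0 // ltW.
  - rewrite -mulr_suml sumrN; move/eqP: splitu; rewrite addr_eq0 => /eqP <-.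
    by rewrite divff // gt_eqF.
  - by apply: zP => //; rewrite !inE jQ andbT; apply: contraNneq uk => <-.
apply: cvx => [k /andP[_ uk]||k /andP[kQ uk]].
- by rewrite divr_ge0 // ltW.
- by rewrite -mulr_suml divff // gt_eqF.
- by apply: zP => //; rewrite !inE jQ andbT; apply: contraNneq uj => ->.
Qed.

(** Apply Helly's theorem to the convex hulls of the subsets with more than a
    fraction [D/(D+1)] of the points: any [D+1] of these subsets share a point.
    A half-space that contains a common point of the hulls cannot have such a
    subset in its complement. *)
Lemma centerpoint (R : realFieldType) (E : finType) (D : nat) (A : {set E}) (x : E -> 'rV[R]_D) :
  (0 < #|A|)%N ->
  exists w : E -> R, [/\ forall e, 0 <= w e, \sum_(e in A) w e = 1 &
    forall a : 'rV[R]_D, dot a (\sum_(e in A) w e *: x e) <= 0 ->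
      (#|A| <= #|[set e in A | (dot a (x e) <= 0)%R]| * D.+1)%N].
Proof.
move=> A0.
pose C (B : {set E}) (y : 'rV[R]_D) := exists w : E -> R,
  [/\ forall e, 0 <= w e, \sum_(e in B) w e = 1 & y = \sum_(e in B) w e *: x e].
pose Q := [set B : {set E} | (B \subset A) && (#|A| * D < #|B| * D.+1)%N].
have [||y yP] := @helly R _ D C Q.
- move=> B P c z c0 c1 /= Cz.
  have /fin_all_exists[W WP] : forall i, exists w : E -> R, P i ->
      [/\ forall e, 0 <= w e, \sum_(e in B) w e = 1 & z i = \sum_(e in B) w e *: x e].
    by move=> i; case Pi: (P i); [have [w ?] := Cz i Pi; exists w|exists (fun=> 0)].
  exists (fun e => \sum_(i | P i) c i * W i e); split.
  + by move=> e; apply: sumr_ge0 => i Pi; rewrite mulr_ge0 ?c0 //; case: (WP i Pi).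
  + rewrite exchange_big /= -[RHS]c1; apply: eq_bigr => i Pi.
    by rewrite -mulr_sumr; case: (WP i Pi) => _ -> _; rewrite mulr1.
  + under [RHS]eq_bigr do rewrite scaler_suml.
    rewrite exchange_big /=; apply: eq_bigr => i Pi; case: (WP i Pi) => _ _ {1}->.
    by rewrite scaler_sumr; apply: eq_bigr => e _; rewrite scalerA.
- move=> Q' sub few.
  suff [e eP] : exists e, forall B, B \in Q' -> e \in B.
    exists (x e) => B /eP eB; exists (fun e' => (e' == e)%:R); split.
    + by move=> e'; case: eqP.
    + by rewrite (bigD1 e) //= eqxx big1 ?addr0 // => i /andP[_ /negbTE ->].
    + rewrite (bigD1 e) //= eqxx scale1r big1 ?addr0 // => i /andP[_ /negbTE ->].
      by rewrite scale0r.
  have /card_gt0P[e0 e0A] := A0.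
  apply: contrapT => none.
  have miss e : e \in A -> exists2 B, B \in Q' & e \notin B.
    move=> eA; apply: contrapT => H; apply: none; exists e => B BQ'.
    by apply: contraT => eB; case: H; exists B.
  have cover : (#|A| <= \sum_(B in Q') #|A :\: B|)%N.
    rewrite -sum1_card; under [leqRHS]eq_bigr do rewrite -sum1_card.
    rewrite (exchange_big_dep (mem A)) /=; last by move=> B e _; rewrite inE => /andP[].
    apply: leq_sum => e eA; have [B BQ' eB] := miss e eA.
    by rewrite (bigD1 B) //= inE eA BQ' eB.
  have small B : B \in Q' -> (#|A :\: B| * D.+1 <= #|A|.-1)%N.
    move=> /(fintype.subsetP sub); rewrite inE => /andP[BA lt].
    have := cardsID B A; rewrite (finset.setIidPr BA) => cA; nia.
  have : (#|A| * D.+1 <= D.+1 * #|A|.-1)%N.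
    apply: leq_trans (leq_mul cover (leqnn _)) _; rewrite big_distrl /=.
    apply: leq_trans (leq_sum _ small) _; rewrite sum_nat_const leq_mul2r few orbT //.
  by nia.
have AQ : A \in Q by rewrite inE fintype.subxx /=; nia.
have [w [w0 w1 yE]] := yP A AQ; exists w; split=> // a; rewrite -yE => ay.
rewrite leqNgt; apply/negP => lt; set B := [set e in A | _] in lt.
have AB : A :\: B \in Q.
  rewrite inE subsetDl /=; have := cardsID B A.
  have -> : A :&: B = B by apply/setP => e; rewrite !inE; case: (e \in A).
  by nia.
have [w' [w'0 w'1 yE']] := yP _ AB; move: ay; rewrite yE' dot_sumr.
have pos e : e \in A :\: B -> 0 < dot a (x e).
  by rewrite !inE => /andP[h eA]; move: h; rewrite eA /= -ltNge.
under eq_bigr do rewrite dotZr.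
apply/negP; rewrite -ltNge lt_neqAle sumr_ge0 ?andbT; last first.
  by move=> e eB; rewrite mulr_ge0 // ltW // pos.
apply/negP => /eqP/esym/psumr_eq0P z.
have : \sum_(e in A :\: B) w' e = 0.
  apply: big1 => e eB; have := z (fun e eB => mulr_ge0 (w'0 e) (ltW (pos e eB))) e eB.
  by move/eqP; rewrite mulf_eq0 (gt_eqF (pos e eB)) orbF => /eqP.
by move/eqP; rewrite w'1 oner_eq0.
Qed.

Local Open Scope classical_set_scope.
Local Open Scope ring_scope.

(** * The enclosed simplex and its barycentric coordinates *)

(** Expand, along its first column, a matrix in which that column repeats the
    [k]-th coordinates of the vectors. *)
Lemma minor_dependence (R : comPzRingType) (n : nat) (v : 'I_n.+1 -> 'rV[R]_n) :
  \sum_(j < n.+1) ((-1) ^+ j * minor j v) *: v j = 0.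
Proof.
apply/rowP => k; rewrite summxE [RHS]mxE.
pose M := \matrix_(i < n.+1, c < n.+1) if unlift ord0 c is Some c' then v i 0 c' else v i 0 k.
transitivity (\det M); last first.
  rewrite -det_tr; apply: (@determinant_alternate _ _ _ ord0 (lift ord0 k)) => // i.
  by rewrite !mxE unlift_none liftK.
rewrite (expand_det_col M ord0). apply: eq_bigr => i _.
rewrite !mxE unlift_none /cofactor addn0 mulrC; congr (_ * (_ * \det _)).
by apply/matrixP => r c; rewrite !mxE liftK.
Qed.

Lemma convex_set2 (R : realType) (M : lmodType R) (A : set (convex_lmodType M)) (x y : M) (t : R) :
  convex_set A -> A x -> A y -> 0 <= t -> t <= 1 -> A (t *: x + (1 - t) *: y).
Proof.
move=> cA Ax Ay t0 t1.
by have := cA x y (Itv01 t0 t1) (mem_set Ax) (mem_set Ay); rewrite inE.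
Qed.

Lemma convex_set_sum (R : realType) (M : lmodType R) (A : set (convex_lmodType M)) (I : Type)
    (s : seq I) (c : I -> R) (z : I -> M) :
  convex_set A -> (forall i, 0 <= c i) -> (forall i, A (z i)) -> \sum_(i <- s) c i = 1 ->
  A (\sum_(i <- s) c i *: z i).
Proof.
move=> cA c0 Az.
suff gen : 0 < \sum_(i <- s) c i ->
    A ((\sum_(i <- s) c i)^-1 *: \sum_(i <- s) c i *: z i).
  by move=> s1; move: gen; rewrite s1 invr1 scale1r; apply.
elim: s => [|i s IH]; first by rewrite big_nil ltxx.
rewrite !big_cons => pos; have S0 : 0 <= \sum_(j <- s) c j by exact: sumr_ge0.
set S := \sum_(j <- s) c j in pos S0 IH *; set Z := \sum_(j <- s) _ in IH *.
have ci : 0 <= c i by [].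
have [Sz|Snz] := eqVneq S 0.
  have -> : Z = 0.
    move: Sz; rewrite /S /Z; elim: (s) => [|j s' IHs]; rewrite ?big_nil // !big_cons.
    move/eqP; rewrite paddr_eq0 ?sumr_ge0 // => /andP[/eqP -> /eqP /IHs ->].
    by rewrite scale0r addr0.
  move: pos; rewrite Sz !addr0 => pos.
  by rewrite scalerA mulVf ?scale1r // gt_eqF.
have Spos : 0 < S by rewrite lt_neqAle eq_sym Snz.
have -> : (c i + S)^-1 *: (c i *: z i + Z) =
    (c i / (c i + S)) *: z i + (1 - c i / (c i + S)) *: (S^-1 *: Z).
  rewrite scalerDr !scalerA [_^-1 * _]mulrC; congr (_ + _ *: _).
  by field; rewrite (gt_eqF pos) Snz.
apply: convex_set2 => //; first exact: IH.
  by rewrite divr_ge0 // ltW.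
by rewrite ler_pdivrMr // mul1r lerDl.
Qed.

Lemma minor_kernel (R : fieldType) (n : nat) (a : 'I_n.+1 -> 'rV[R]_n) (j : 'I_n.+1) (x : 'rV[R]_n) :
  minor j a != 0 -> (forall i, i != j -> dot (a i) x = 0) -> x = 0.
Proof.
move=> nz H; have U : (\matrix_(i < n) a (lift j i))%R \in unitmx by rewrite unitmxE unitfE.
apply: trmx_inj; rewrite trmx0 -(mulKmx U x^T).
have -> : (\matrix_(i < n) a (lift j i))%R *m x^T = 0; last by rewrite mulmx0.
have ne i : lift j i != j by rewrite eq_sym neq_lift.
apply/colP => i; rewrite [RHS]mxE -[RHS](H _ (ne i)).
by rewrite !mxE; apply: eq_bigr => k _; rewrite !mxE.
Qed.

Lemma minor_solve (R : fieldType) (n : nat) (a : 'I_n.+1 -> 'rV[R]_n) (b : 'I_n.+1 -> R) (j : 'I_n.+1) :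
  minor j a != 0 -> exists x : 'rV[R]_n, forall i, i != j -> dot (a i) x = b i.
Proof.
move=> nz; have U : (\matrix_(i < n) a (lift j i))%R \in unitmx by rewrite unitmxE unitfE.
pose y := invmx (\matrix_(i < n) a (lift j i))%R *m (\col_i b (lift j i))%R.
exists y^T => i; rewrite eq_sym => /unlift_some[i' -> _].
have := mulKVmx U (\col_i b (lift j i))%R; rewrite -/y => /colP/(_ i').
rewrite [RHS]mxE => <-; rewrite mxE; apply: eq_bigr => k _; rewrite !mxE //.
Qed.

Definition hyperplane (R : realType) (d : nat) (a : 'rV[R]_d) (b : R) : set 'rV[R]_d :=
  [set x | \sum_(k < d) a 0 k * x 0 k = b].

Lemma hyperplaneE (R : realType) (d : nat) (a : 'rV[R]_d) (b : R) x :
  hyperplane a b x <-> dot a x = b.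
Proof. by []. Qed.

Lemma convex_hyperplane (R : realType) (d : nat) (a : 'rV[R]_d) (b : R) :
  @convex_set R 'rV[R]_d (hyperplane a b).
Proof.
move=> x y t; rewrite !inE => /hyperplaneE xb /hyperplaneE yb; apply/hyperplaneE.
by rewrite dotDr !dotZr xb yb -mulrDl [_ + _](addrC _ _) subrK mul1r.
Qed.

(** The vertices [P j] are forced, as [minor j a] does not vanish.  The
    quantity [\sum_j mu j * (dot (a j) x - b j)] is constant in [x], and
    evaluation at [P j] shows that the [j]-th barycentric coordinate of [q] is
    [mu j * (dot (a j) q - b j)] divided by this constant, which is nonzero
    because the hyperplanes have no common point.  Both cases of the sign
    hypothesis can occur, since the constant may have either sign. *)
Lemma in_enclosed_simplex (R : realType) (d : nat) (a : 'I_d.+1 -> 'rV[R]_d) (b mu : 'I_d.+1 -> R)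
    (q : 'rV[R]_d) :
  (forall j, mu j != 0) -> \sum_j mu j *: a j = 0 -> (forall j, minor j a != 0) ->
  ~ (exists x, forall j, hyperplane (a j) (b j) x) ->
  (forall j, mu j * (dot (a j) q - b j) <= 0) \/ (forall j, 0 <= mu j * (dot (a j) q - b j)) ->
  q \in enclosed_simplex (fun j => hyperplane (a j) (b j)).
Proof.
move=> mu0 dep nz nocommon side.
have /fin_all_exists[P PE] j : exists x, forall i, i != j -> dot (a i) x = b i.
  exact: minor_solve.
have Puniq j x : (forall i, i != j -> dot (a i) x = b i) -> x = P j.
  move=> xb; apply/eqP; rewrite -subr_eq0; apply/eqP; apply: (minor_kernel (nz j)) => i ij.
  by rewrite dotBr xb // PE // subrr.
pose l j x := dot (a j) x - b j.
have lP i j : i != j -> l i (P j) = 0 by move=> ij; rewrite /l PE // subrr.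
have lP0 j : l j (P j) != 0.
  rewrite subr_eq0; apply/eqP => e; apply: nocommon; exists (P j) => i; apply/hyperplaneE.
  by have [->|ij] := eqVneq i j; rewrite ?e // PE.
pose B := \sum_j mu j * b j.
have muL x : \sum_j mu j * l j x = - B.
  rewrite /l; under eq_bigr do rewrite mulrBr; rewrite sumrB.
  under eq_bigr do rewrite dotC -dotZr; rewrite -dot_sumr dep.
  by rewrite -(scale0r x) dotZr mul0r sub0r.
have muLP j : mu j * l j (P j) = - B.
  by rewrite -(muL (P j)) (bigD1 j) //= big1 ?addr0 // => i ij; rewrite lP ?mulr0.
have B0 : B != 0 by rewrite -oppr_eq0 -(muLP ord0) mulf_neq0.
pose c j := mu j * l j q / - B.
have NB0 : - B != 0 by rewrite oppr_eq0.
have c1 : \sum_j c j = 1 by rewrite /c -mulr_suml muL divff.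
have cE j : c j * l j (P j) = l j q.
  have -> : l j (P j) = - B / mu j by rewrite -(muLP j) mulrAC divff ?mul1r.
  by rewrite /c; field; rewrite B0 mu0.
have c0 j : 0 <= c j.
  case: side => h.
    have : - B <= 0 by rewrite -(muL q); apply: sumr_le0 => i _; exact: h.
    by move=> Ble; rewrite /c mulr_le0 ?h // invr_le0.
  have : 0 <= - B by rewrite -(muL q); apply: sumr_ge0 => i _; exact: h.
  by move=> Bge; rewrite /c mulr_ge0 ?h // invr_ge0.
have lcomb i : l i (\sum_j c j *: P j) = l i q.
  transitivity (\sum_j c j * l i (P j)).
    rewrite /l dot_sumr; under [RHS]eq_bigr do rewrite mulrBr -dotZr.
    by rewrite sumrB -mulr_suml c1 mul1r.
  by rewrite (bigD1 i) //= big1 ?addr0 // => j ij; rewrite lP ?mulr0 // eq_sym.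
have qE : q = \sum_j c j *: P j.
  apply/eqP; rewrite -subr_eq0; apply/eqP; apply: (minor_kernel (nz ord0)) => i _.
  by rewrite dotBr; move: (lcomb i); rewrite /l => /addIr ->; rewrite subrr.
have qhull : convex_hull (range P) q.
  move=> A [cA PA]; rewrite qE; apply: convex_set_sum => // j.
  by apply: PA; exists j.
have enclosed D : is_enclosed_simplex (fun j => hyperplane (a j) (b j)) D -> D q.
  case=> v [_ -> facet].
  have -> // : v = P.
  apply/funext => j; apply: Puniq => i ij; apply/hyperplaneE; apply: facet.
  by apply: sub_gen_smallest; exists j => //=; rewrite eq_sym.
have ex : exists D, is_enclosed_simplex (fun j => hyperplane (a j) (b j)) D.
  exists (convex_hull (range P)), P; split=> //.
    move=> w w0 wP i; have : \sum_k w k * l i (P k) = 0.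
      rewrite /l; under eq_bigr do rewrite mulrBr -dotZr.
      by rewrite sumrB -dot_sumr wP -mulr_suml w0 mul0r subr0 -(scale0r (a i)) dotZr mul0r.
    rewrite (bigD1 i) //= big1 ?addr0 => [|k ki]; last by rewrite lP ?mulr0 // eq_sym.
    by move/eqP; rewrite mulf_eq0 (negbTE (lP0 i)) orbF => /eqP.
  move=> i; apply: smallest_sub; first exact: convex_hyperplane.
  by move=> _ [j /= ji <-]; apply/hyperplaneE; rewrite PE // eq_sym.
rewrite inE; apply: enclosed; case: ex => D HD.
exact: (@xgetPex _ set0 [set D | is_enclosed_simplex (fun j => hyperplane (a j) (b j)) D] (ex_intro _ D HD)).
Qed.

(** * Choice of the sample size, and the total loss *)

Lemma leq_expn2r a b n : (a <= b -> a ^ n <= b ^ n)%N.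
Proof. by move=> ab; elim: n => // n IH; rewrite !expnS leq_mul. Qed.

(** That is, [(1 - 1/r)^r <= 1/2]. *)
Lemma bernoulli_half (r : nat) : (0 < r -> 2 * r.-1 ^ r <= r ^ r)%N.
Proof.
case: r => // r _ /=.
suff : (r ^ r * (r + r.+1) <= r.+1 ^ r.+1)%N by rewrite (expnS r r); nia.
have gen n : (r ^ n * (r + n.+1) <= r.+1 ^ n.+1)%N.
  elim: n => [|n IH]; first by rewrite expn0 expn1; lia.
  by rewrite (expnS r.+1) (expnS r n); nia.
exact: gen.
Qed.

(** With [r * u] members of the sample outside the defining positions, the
    probability in [card_survivors] is at most [2^-u], by [bernoulli_half]; this
    is the value of [u] that beats [cell_count]. *)
Definition halvings (m : nat) : nat := 16 * m.+2 ^ 4.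
Definition crossing_bound (m : nat) : nat := (8 * m.+1) ^ m.+1.
Definition sample_size (m : nat) : nat := m.+1 * m + crossing_bound m * halvings m.

(** Every factor is bounded by a power of [m+2], which is at least [2]. *)
Lemma cell_count_le (m : nat) : (cell_count m (sample_size m) <= m.+2 ^ (9 * m.+2 ^ 3))%N.
Proof.
rewrite /cell_count /sample_size /crossing_bound /halvings; set D := m.+2.
have D2 : (2 <= D)%N by [].
have pw a b : (a <= b -> D ^ a <= D ^ b)%N by move=> ab; apply: leq_pexp2l.
have e8 : (8 * m.+1 <= D ^ 4)%N.
  have : (2 ^ 3 <= D ^ 3)%N by exact: leq_expn2r.
  by rewrite (expnS D 3) => h; have : (m.+1 <= D)%N by []; nia.
have e1 : ((8 * m.+1) ^ m.+1 <= D ^ (4 * D))%N.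
  by apply: leq_trans (leq_expn2r _ e8) _; rewrite -expnM; apply: pw; rewrite /D; lia.
have e2 : (16 * D ^ 4 <= D ^ 8)%N.
  by rewrite (expnD D 4 4) leq_mul2r; apply/orP; right; exact: (@leq_expn2r 2 D 4).
have e3 : (m.+1 * m <= D ^ (4 * D) * D ^ 8)%N.
  rewrite -expnD; apply: (@leq_trans (D ^ 2)%N); first by rewrite /D; nia.
  by apply: pw; lia.
have e4 : (D * (m.+1 * m + (8 * m.+1) ^ m.+1 * (16 * D ^ 4)) <= D ^ (9 * D))%N.
  apply: (@leq_trans (D ^ 2 * (D ^ (4 * D) * D ^ 8))%N); last first.
    by rewrite -!expnD; apply: pw; lia.
  have := leq_mul e1 e2; set Z := (D ^ (4 * D) * D ^ 8)%N in e3 *.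
  by rewrite (expnS D 1) expn1; nia.
apply: leq_trans (leq_mul (leq_expn2r _ e4) (leq_expn2r m.+1 D2)) _.
rewrite -expnM -expnD; apply: pw; rewrite (expnS D 2) expnS expn1 /D; nia.
Qed.

Lemma sample_size_okP (m : nat) : sample_size_ok m (sample_size m) (crossing_bound m).
Proof.
have r0 : (0 < crossing_bound m)%N by rewrite expn_gt0.
have u0 : (0 < halvings m)%N by rewrite muln_gt0 expn_gt0.
split=> //.
- by rewrite addn_gt0 [(0 < crossing_bound m * _)%N]muln_gt0 r0 u0 orbT.
- exact: leq_addr.
rewrite addKn expnM; set u := halvings m; set r := crossing_bound m in r0 *.
have half : (2 ^ u * (r.-1 ^ r) ^ u <= r ^ (r * u))%N.
  by rewrite -expnMn expnM; apply: leq_expn2r; exact: bernoulli_half.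
have small : (cell_count m (sample_size m) < 2 ^ u)%N.
  apply: leq_ltn_trans (cell_count_le m) _.
  apply: (@leq_ltn_trans ((2 ^ m.+2) ^ (9 * m.+2 ^ 3))%N).
    by apply: leq_expn2r; rewrite ltnW // ltn_expl.
  rewrite -expnM ltn_exp2l // /u /halvings (expnS _ 3).
  have : (0 < m.+2 ^ 3)%N by rewrite expn_gt0.
  nia.
have [-> |p0] := posnP ((r.-1 ^ r) ^ u)%N; first by rewrite muln0 expn_gt0 r0.
by apply: leq_trans half; rewrite ltn_pmul2r.
Qed.

Lemma loss_le (m : nat) :
  ((2 * cell_count m (sample_size m)) ^ m.+2 * (m.+1 + 1).+1 <= m.+2 ^ (192 * m.+1 ^ 4))%N.
Proof.
have c := cell_count_le m; set D := m.+2 in c *.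
have D2 : (2 <= D)%N by [].
have -> : (m.+1 + 1).+1 = D.+1 by rewrite addn1.
have e1 : (2 * cell_count m (sample_size m) <= D ^ (9 * D ^ 3).+1)%N by rewrite expnS leq_mul.
have e2 : (D.+1 <= D ^ 2)%N by rewrite expnS expn1; nia.
apply: leq_trans (leq_mul (leq_expn2r _ e1) e2) _.
rewrite -expnM -expnD; apply: leq_pexp2l => //.
have e3 : (D ^ 4 <= (2 * m.+1) ^ 4)%N by apply: leq_expn2r; rewrite /D; lia.
rewrite expnMn in e3.
have e4 : ((9 * D ^ 3).+1 * D + 2 <= 12 * D ^ 4)%N.
  have : (D <= D ^ 4)%N by rewrite expnS leq_pmulr // expn_gt0.
  have : (2 <= D ^ 4)%N by apply: leq_trans D2 _; rewrite expnS leq_pmulr // expn_gt0.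
  by rewrite (expnS D 3) mulSn -mulnA [(D ^ 3 * D)%N]mulnC; lia.
by apply: leq_trans e4 _; lia.
Qed.

(** * The selection *)

Lemma dot_row_mx (R : comPzRingType) (m n : nat) (x1 y1 : 'rV[R]_m) (x2 y2 : 'rV[R]_n) :
  dot (row_mx x1 x2) (row_mx y1 y2) = dot x1 y1 + dot x2 y2.
Proof.
rewrite /dot big_split_ord /=; congr (_ + _); apply: eq_bigr => k _.
  by rewrite !row_mxEl.
by rewrite !row_mxEr.
Qed.

(** The centerpoint hyperplanes of the families other than the first meet in
    [q].  As [q] lies on them, the centerpoint property holds for both of their
    sides, so that the orientations [kappa] can be prescribed arbitrarily and a
    single global sign [sigma] accounts for the first family. *)
Lemma deep_point (R : realFieldType) (E : finType) (m : nat) (p : E -> 'rV[R]_m.+1) (b : E -> R)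
    (A : 'I_m.+2 -> {set E}) (tau : bool) :
  (forall i, (0 < #|A i|)%N) ->
  (forall h, selects A h -> 0 < (-1) ^+ tau * minor ord0 (p \o h)) ->
  exists q : 'rV[R]_m.+1, forall kappa : 'I_m.+2 -> R, exists2 sigma : R, sigma ^+ 2 = 1 &
    forall i, (#|A i| <= #|[set e in A i | (sigma * (kappa i * (dot (p e) q - b e)) <= 0)%R]|
                         * (m.+1 + 1).+1)%N.
Proof.
move=> A0 sgn.
(* A point q acts on the pairs (a, b) through the linear form (q, -1). *)
pose x e : 'rV[R]_(m.+1 + 1) := row_mx (p e) (b e)%:M.
have /fin_all_exists[w wP] i : exists w : E -> R, [/\ forall e, 0 <= w e, \sum_(e in A i) w e = 1 &
    forall a : 'rV[R]_(m.+1 + 1), dot a (\sum_(e in A i) w e *: x e) <= 0 ->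
      (#|A i| <= #|[set e in A i | (dot a (x e) <= 0)%R]| * (m.+1 + 1).+1)%N].
  exact: centerpoint.
pose al i := \sum_(e in A i) w i e *: p e.
pose be i := \sum_(e in A i) w i e * b e.
have alnz : minor ord0 al != 0.
  suff : 0 < (-1) ^+ tau * \det (\matrix_(i < m.+1) nth 0 (omit al ord0) i).
    move=> pos; apply: contraTneq pos; rewrite /minor => z.
    suff -> : (\matrix_(i < m.+1) nth 0 (omit al ord0) i) = \matrix_(i < m.+1) al (lift ord0 i).
      by rewrite z mulr0 ltxx.
    by apply/row_matrixP => i; rewrite !rowK nth_omit.
  apply: (@multilinear_convex_pos R _ E p (omit A ord0)
            (fun s => (-1) ^+ tau * \det (\matrix_(i < m.+1) nth 0 s i))).
  - rewrite size_omit => s1 s2 a y z sz; rewrite (det_multilinear _ _ _ sz); ring.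
  - have /fin_all_exists[pick pickA] : forall i, exists e, e \in A i by move=> i; apply/card_gt0P.
    move=> t /(transversalP (pick ord0)); rewrite size_omit => -[sz tA].
    pose h (i : 'I_m.+2) := if unlift ord0 i is Some i' then nth (pick ord0) t i' else pick ord0.
    have hA : selects A h.
      move=> i; rewrite /h; case: unliftP => [i' ->|->] //.
      by have := tA i' (ltn_ord _); rewrite nth_omit.
    have := sgn h hA; congr (0 < _ * \det _).
    by apply/row_matrixP => i; rewrite !rowK /= (nth_map (pick ord0)) ?sz // /h liftK.
  - by rewrite !size_omit.
  - rewrite size_omit => i lt; have [w0 w1 _] := wP (lift ord0 (Ordinal lt)).
    by exists (w (lift ord0 (Ordinal lt))); rewrite !(nth_omit _ _ _ (Ordinal lt)); split.
have [q qE] := minor_solve be alnz.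
exists q => kappa.
have dotx c i : dot (c *: row_mx q (-1)) (\sum_(e in A i) w i e *: x e) = c * (dot (al i) q - be i).
  rewrite dotC dotZr dotC dot_sumr; congr (_ * _).
  rewrite /al /be dotC dot_sumr -sumrB; apply: eq_bigr => e _.
  rewrite !dotZr dot_row_mx mulrDr; congr (_ + _).
  rewrite /dot big_ord1 !mxE !eqxx !mulr1n. ring.
have dotxe c e : dot (c *: row_mx q (-1)) (x e) = c * (dot (p e) q - b e).
  rewrite dotC dotZr dotC dot_row_mx [dot q _]dotC; congr (_ * (_ + _)).
  rewrite /dot big_ord1 !mxE !eqxx !mulr1n. ring.
have [sigma s2 s0] : exists2 sigma : R, sigma ^+ 2 = 1 &
    sigma * kappa ord0 * (dot (al ord0) q - be ord0) <= 0.
  have [le|ge] := lerP (kappa ord0 * (dot (al ord0) q - be ord0)) 0.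
    by exists 1; rewrite ?expr1n // mul1r.
  by exists (-1); rewrite ?sqrrN ?expr1n // mulN1r mulNr oppr_le0 ltW.
exists sigma => // i; have [_ _ deep] := wP i.
have := deep ((sigma * kappa i) *: row_mx q (-1)); rewrite dotx => H.
apply: leq_trans (H _) _.
  by have [->//|i0] := eqVneq i ord0; rewrite qE // subrr mulr0.
rewrite leq_mul2r; apply/orP; right; apply: subset_leq_card; apply/fintype.subsetP => e.
by rewrite !inE dotxe -!mulrA.
Qed.

(** Otherwise some nonzero vector is orthogonal to the [m+1] normals, and
    translating the common point along it yields another common point. *)
Lemma general_position_minor (R : realType) (m : nat) (I : 'I_m.+2 -> finType)
    (L : forall i, I i -> set 'rV[R]_m.+1) (p : {i & I i} -> 'rV[R]_m.+1) (b : {i & I i} -> R)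
    (j : 'I_m.+2) (h : 'I_m.+2 -> {i & I i}) :
  (forall e, L (tag e) (tagged e) = hyperplane (p e) (b e)) ->
  general_position L -> (forall i, tag (h i) = i) -> minor j (p \o h) != 0.
Proof.
move=> LE [_ meet _] tagh; apply/negP => /eqP det0.
have inj : injective (h \o lift j).
  by move=> i i' /(congr1 tag) /=; rewrite !tagh => /lift_inj.
have card : #|[set (h \o lift j) i | i : 'I_m.+1]%SET| = m.+1 by rewrite card_imset // card_ord.
have [x xE] := meet _ card.
have /eqP : \det (\matrix_(i < m.+1) p (h (lift j i)))^T = 0 by rewrite det_tr.
case/det0P => v v0 vN.
have vh i : dot (p (h (lift j i))) v = 0.
  have := congr1 (fun M : 'rV_m.+1 => M 0 i) vN; rewrite mxE [RHS]mxE dotC => e; rewrite -[RHS]e.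
  by apply: eq_bigr => k _; rewrite !mxE.
have xin e : e \in [set (h \o lift j) i | i : 'I_m.+1]%SET -> dot (p e) x = b e.
  have : [set x] x by [].
  by rewrite -xE => H eA; have := H e eA; rewrite LE.
have : (\bigcap_(t in [set` [set (h \o lift j) i | i : 'I_m.+1]%SET]) L (tag t) (tagged t)) (x + v).
  move=> e /= eA; rewrite LE; apply/hyperplaneE; rewrite dotDr (xin e eA).
  by case/imsetP: eA => i _ -> /=; rewrite vh addr0.
rewrite xE => /= /eqP; rewrite -subr_eq0 addrC addKr; exact/negP.
Qed.

Lemma homogeneous_selection (R : realType) (m : nat) (I : 'I_m.+2 -> finType)
    (L : forall i, I i -> set 'rV[R]_m.+1) :
  (forall i (x : I i), is_hyperplane (L i x)) -> general_position L ->
  exists (L' : forall i, {set I i}) (q : 'rV[R]_m.+1),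
    (forall i, (#|I i| <= #|L' i| * ((2 * cell_count m (sample_size m)) ^ m.+2 * (m.+1 + 1).+1))%N) /\
    (forall h : (forall i, I i), (forall i, h i \in L' i) ->
       q \in enclosed_simplex (fun i => L i (h i))).
Proof.
move=> hypL gp; set N := (_ ^ _ * _)%N.
have N0 : (0 < N)%N.
  have [_ s0 _ _ _] := sample_size_okP m.
  by rewrite /N muln_gt0 expn_gt0 muln_gt0 /cell_count muln_gt0 !expn_gt0 muln_gt0 s0.
have [[i0 Ii0]|allne] := pselect (exists i, #|I i| = 0%N).
  exists (fun i => [set: I i]%SET), 0; split=> [i|h _]; first by rewrite cardsT leq_pmulr.
  by exfalso; move/eqP: Ii0; apply/negP; rewrite -lt0n; apply/card_gt0P; exists (h i0).
have I0 i : (0 < #|I i|)%N by rewrite lt0n; apply/eqP => e; apply: allne; exists i.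
pose E : finType := {i : 'I_m.+2 & I i}.
have /fin_all_exists[pb pbE] : forall e : E, exists pb : 'rV[R]_m.+1 * R,
    L (tag e) (tagged e) = hyperplane pb.1 pb.2.
  by move=> e; have [a [c [_ ->]]] := hypL _ (tagged e); exists (a, c).
pose p (e : E) := (pb e).1; pose b (e : E) := (pb e).2.
pose A i := [set e : E | tag e == i]%SET.
have cA i : #|A i| = #|I i|.
  rewrite -(card_imset predT (@eq_from_Tagged _ I i)); apply: eq_card => e; rewrite !inE.
  apply/eqP/imsetP => [<-|[y _ ->//]]; exists (tagged e) => //.
  by case: e.
have A0 i : (0 < #|A i|)%N by rewrite cA.
have nz j h : selects A h -> minor j (p \o h) != 0.
  move=> hA; apply: (general_position_minor (b := b) j pbE gp) => i.
  by apply/eqP; have := hA i; rewrite inE.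
have [A' [subA [tau tauP]]] := minor_signs (sample_size_okP m) A0 nz.
have A'0 i : (0 < #|A' i|)%N by case: (subA i).
have [q qP] := deep_point b A'0 (tauP ord0).
(* The sign of the i-th coefficient in the dependence between the normals. *)
pose kappa (i : 'I_m.+2) : R := (-1) ^+ i * (-1) ^+ tau i.
have [sigma s2 deep] := qP kappa.
pose B i := [set e in A' i | (sigma * (kappa i * (dot (p e) q - b e)) <= 0)%R]%SET.
exists (fun i => [set x | Tagged I x \in B i]%SET), q; split=> [i|h hB].
  have [sA _ cA'] := subA i; rewrite -cA; apply: leq_trans cA' _.
  rewrite /N [(_ ^ m.+2 * (m.+1 + 1).+1)%N]mulnC mulnA leq_mul2r; apply/orP; right; apply: leq_trans (deep i) _.
  rewrite leq_mul2r; apply/orP; right.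
  apply: leq_trans (leq_imset_card (Tagged I (i := i)) _); apply: subset_leq_card.
  apply/fintype.subsetP => e eB; have /eqP ti : tag e == i.
    by move: (eB); rewrite inE => /andP[/(fintype.subsetP sA)]; rewrite inE.
  case: e ti eB => k y /= ki; subst k => eB.
  by apply/imsetP; exists y => //; rewrite inE.
pose h' i : E := Tagged I (h i).
have h'B i : h' i \in B i by have := hB i; rewrite inE.
have h'A' : selects A' h' by move=> i; have := h'B i; rewrite inE => /andP[].
have h'A : selects A h' by apply: selects_sub h'A' => i; case: (subA i).
have -> : (fun i => L i (h i)) = (fun i => hyperplane (p (h' i)) (b (h' i))).
  by apply/funext => i; rewrite -pbE.
have signE (i : 'I_m.+2) : (-1) ^+ i * minor i (p \o h') * (dot (p (h' i)) q - b (h' i)) =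
    ((-1) ^+ tau i * minor i (p \o h')) * (kappa i * (dot (p (h' i)) q - b (h' i))).
  have t2 : (-1) ^+ tau i * (-1) ^+ tau i = 1 :> R by case: (tau i); rewrite ?expr0 ?expr1; ring.
  rewrite /kappa; move: ((-1) ^+ tau i) t2 ((-1) ^+ i) => t t2 a.
  by rewrite -[LHS]mul1r -t2; ring.
apply: (in_enclosed_simplex (mu := fun i : 'I_m.+2 => (-1) ^+ i * minor i (p \o h'))).
- by move=> j; rewrite mulf_neq0 ?signr_eq0 ?nz.
- exact: (minor_dependence (p \o h')).
- by move=> j; exact: nz.
- case=> x xh; case: gp => _ _ empty.
  have inj : injective h' by move=> i i' /(congr1 tag).
  have card : #|[set h' i | i : 'I_m.+2]%SET| = m.+2 by rewrite card_imset // card_ord.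
  have : (\bigcap_(t in [set` [set h' i | i : 'I_m.+2]%SET]) L (tag t) (tagged t)) x.
    by move=> e /= /imsetP[i _ ->]; rewrite pbE; exact: xh.
  by rewrite empty.
- have sB i : sigma * (kappa i * (dot (p (h' i)) q - b (h' i))) <= 0.
    by have := h'B i; rewrite inE => /andP[].
  have /orP[/eqP s1|/eqP s1] : (sigma == 1) || (sigma == -1) by rewrite -sqrf_eq1 s2.
    left=> i; rewrite signE pmulr_rle0 ?tauP //.
    by have := sB i; rewrite s1 mul1r.
  right=> i; rewrite signE pmulr_rge0 ?tauP //.
  by have := sB i; rewrite s1 mulN1r oppr_le0.
Qed.

Lemma powR2_loss (R : realType) (d : nat) :
  2 `^ (- (192%:R / ln 2 * d%:R ^+ 4 * ln d.+1%:R)) = (d.+1 ^ (192 * d ^ 4))%:R^-1 :> R.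
Proof.
have l2 : ln 2 != 0 :> R by rewrite gt_eqF // ln_gt0 // ltr1n.
rewrite powRN; congr (_^-1); rewrite /powR pnatr_eq0 /=.
have -> : 192%:R / ln 2 * d%:R ^+ 4 * ln d.+1%:R * ln 2 = (192 * d ^ 4)%:R * ln d.+1%:R :> R.
  by rewrite natrM natrX; field.
by rewrite expRM_natl lnK ?natrX // posrE ltr0n.
Qed.

Theorem theorem1p5 (R : realType) :
  exists C : R, 0 < C /\
    forall (d : nat) (I : 'I_d.+1 -> finType)
           (L : forall i, I i -> set 'rV[R]_d),
      (0 < d)%N ->
      (forall i (x : I i), is_hyperplane (L i x)) ->
      general_position L ->
      exists (L' : forall i, {set I i}) (q : 'rV[R]_d),
        (forall i, 2 `^ (- (C * d%:R ^+ 4 * ln d.+1%:R)) * #|I i|%:R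
                     <= #|L' i|%:R) /\
        (forall h : (forall i, I i), (forall i, h i \in L' i) ->
           q \in enclosed_simplex (fun i => L i (h i))).
Proof.
exists (192%:R / ln 2); split; first by rewrite divr_gt0 ?ltr0n // ln_gt0 // ltr1n.
case=> // m I L _ hypL gp.
have [L' [q [large inside]]] := homogeneous_selection hypL gp.
exists L', q; split=> // i; rewrite powR2_loss mulrC ler_pdivrMr ?ltr0n ?expn_gt0 //.
rewrite -natrM ler_nat; apply: leq_trans (large i) _.
by rewrite leq_mul2l loss_le orbT.
Qed.
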